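(* There is an isomorphism of groups $$W(\widetilde{T}_A)\cong W(R_A)\ltimes K_0(R_A).$$ In particular, with $\chi_A:=2+\sum_{i=1}^r(1/a_i-1)$: $W(\widetilde{T}_A)\cong W(\widetilde{R}_A)$ if $\chi_A\neq0$, and $W(\widetilde{T}_A)$ is isomorphic to the hyperbolic extension of the elliptic Weyl group $W(\widetilde{R}_A)$ if $\chi_A=0$.
   Context: Let $r\ge3$ and let $A=(a_1,\dots,a_r)$ be a tuple of integers $\ge2$. **The root system $R_A$.** $T_A=\{1\}\sqcup\{(i,j):1\le i\le r,\ 1\le j\le a_i-1\}$. $K_0(R_A)$ is the free abelian group with basis $\{\alpha_v\}_{v\in T_A}$, with symmetric bilinear form $I_{R_A}(\alpha_v,\alpha_v)=2$, $I_{R_A}(\alpha_1,\alpha_{(i,1)})=-1$, $I_{R_A}(\alpha_{(i,j)},\alpha_{(i,j+1)})=-1$, and $0$ for all other pairs of distinct basis elements. $W(R_A)\subset\mathrm{Aut}(K_0(R_A),I_{R_A})$ is generated by $r_v(\lambda)=\lambda-I_{R_A}(\lambda,\alpha_v)\alpha_v$, $v\in T_A$. The semi-direct product $W(R_A)\ltimes K_0(R_A)$ is formed with respect to the natural action of $W(R_A)$ on $K_0(R_A)$. **The root system $\widetilde{R}_A$.** $\widetilde{T}_A=T_A\sqcup\{1^*\}$. $K_0(\widetilde{R}_A)$ is the free abelian group with basis $\{\widetilde{\alpha}_v\}_{v\in\widetilde{T}_A}$, with symmetric bilinear form $I_{\widetilde{R}_A}(\widetilde{\alpha}_v,\widetilde{\alpha}_{v'})=I_{R_A}(\alpha_v,\alpha_{v'})$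 for $v,v'\in T_A$, $I_{\widetilde{R}_A}(\widetilde{\alpha}_{1^*},\widetilde{\alpha}_{1^*})=2$, $I_{\widetilde{R}_A}(\widetilde{\alpha}_{1^*},\widetilde{\alpha}_1)=2$, $I_{\widetilde{R}_A}(\widetilde{\alpha}_{1^*},\widetilde{\alpha}_{(i,1)})=-1$, $I_{\widetilde{R}_A}(\widetilde{\alpha}_{1^*},\widetilde{\alpha}_{(i,j)})=0$ for $j\ge2$. $W(\widetilde{R}_A)\subset\mathrm{Aut}(K_0(\widetilde{R}_A),I_{\widetilde{R}_A})$ is generated by $\widetilde{r}_v(\lambda)=\lambda-I_{\widetilde{R}_A}(\lambda,\widetilde{\alpha}_v)\widetilde{\alpha}_v$, $v\in\widetilde{T}_A$. **The generalized Coxeter group $W(\widetilde{T}_A)$.** It is the group with generators $\widetilde{w}_v$, $v\in\widetilde{T}_A$, and relations: (W0) $\widetilde{w}_v^2=1$ for all $v\in\widetilde{T}_A$; (W1.0) $\widetilde{w}_v\widetilde{w}_{v'}=\widetilde{w}_{v'}\widetilde{w}_v$ if $I_{\widetilde{R}_A}(\widetilde{\alpha}_v,\widetilde{\alpha}_{v'})=0$; (W1.1) $\widetilde{w}_v\widetilde{w}_{v'}\widetilde{w}_v=\widetilde{w}_{v'}\widetilde{w}_v\widetilde{w}_{v'}$ if $I_{\widetilde{R}_A}(\widetilde{\alpha}_v,\widetilde{\alpha}_{v'})=-1$; (W2) $\widetilde{w}_{(i,1)}\sigma_1\widetilde{w}_{(i,1)}\sigma_1=\sigma_1\widetilde{w}_{(i,1)}\sigma_1\widetilde{w}_{(i,1)}$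 for all $i=1,\dots,r$; (W3) $\widetilde{w}_{(i,1)}\sigma_{(j,1)}=\sigma_{(j,1)}\widetilde{w}_{(i,1)}$ and $\widetilde{w}_{(j,1)}\sigma_{(i,1)}=\sigma_{(i,1)}\widetilde{w}_{(j,1)}$ for all $1\le i<j\le r$; where $\sigma_1:=\widetilde{w}_1\widetilde{w}_{1^*}$ and $\sigma_{(i,1)}:=\widetilde{w}_{(i,1)}\sigma_1\widetilde{w}_{(i,1)}\sigma_1^{-1}$. **Terminology.** If $\chi_A=0$, $W(\widetilde{R}_A)$ is called the elliptic Weyl group of type $A$. In that case the group $W(R_A)\ltimes K_0(R_A)$ is (isomorphic to) a non-trivial central extension of $W(\widetilde{R}_A)$ by $\mathbb{Z}$, and it is this extension that is called the hyperbolic extension of the elliptic Weyl group. *)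

(* Defs.v *)
From HB Require Import structures.
From mathcomp Require Import all_boot all_order all_algebra.
From mathcomp Require Import boolp ring.

Set Implicit Arguments.
Unset Strict Implicit.
Unset Printing Implicit Defensive.

Import GRing.Theory.
Local Open Scope ring_scope.
Local Open Scope quotient_scope.

(* In a multiplicative map between groups, 1 and inverses are automatically
   preserved. *)
Definition group_isomorphic (G H : groupType) : Prop :=
  exists f : {multiplicative G -> H}, bijective f.

(* 1 -> Z -> E -> G -> 1 with Z central in E; int is written additively. *)
Definition central_extension_by_Z (E G : groupType)
    (iota : int -> E) (p : {multiplicative E -> G}) : Prop :=
  [/\ {morph iota : m n / m + n >-> (m * n)%g},
      injective iota,
      forall g : G, exists e : E, p e = g,
      forall e : E, p e = 1%g <-> exists n, e = iota n
    & forall n e, commute (iota n) e].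

(* A central extension is trivial, i.e. equivalent to the product extension,
   exactly when its projection has a section that is a morphism. *)
Definition trivial_extension (E G : groupType) (p : {multiplicative E -> G}) :
    Prop :=
  exists s : {multiplicative G -> E}, cancel s p.

Definition nontrivial_central_extension_by_Z (E G : groupType) : Prop :=
  exists (iota : int -> E) (p : {multiplicative E -> G}),
    central_extension_by_Z iota p /\ ~ trivial_extension p.

Section GeneratedSubgroup.
Variables (G : groupType) (S : G -> Prop).

Definition generated : pred G := fun x =>
  `[< forall H : {pred G}, group_closed H -> (forall s, S s -> s \in H) ->
        x \in H >].

Lemma generated_closed : group_closed generated.
Proof.
split=> [|x y /asboolP gx /asboolP gy]; apply/asboolP => H cH sH.
  by case: cH.
by case: (cH) => _; apply; [apply: gx | apply: gy].
Qed.

Lemma generated_sub s : S s -> s \in generated.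
Proof. by move=> Ss; apply/asboolP => H _; apply. Qed.

Definition subgroup_generated : Type := {x : G | generated x}.
HB.instance Definition _ := Choice.on subgroup_generated.
HB.instance Definition _ := [isSub of subgroup_generated for sval].
HB.instance Definition _ :=
  SubChoice_isSubGroup.Build G generated subgroup_generated generated_closed.

End GeneratedSubgroup.

Section Presentation.
(* The letter (x, false) stands for x and (x, true) for its inverse. *)
Variable X : choiceType.
Definition word : choiceType := seq (X * bool).

Definition letter (x : X) : word := [:: (x, false)].
Definition winv (u : word) : word := rev [seq (l.1, ~~ l.2) | l <- u].

Variable R : word -> word -> Prop.

Inductive pres_eq : word -> word -> Prop :=
| pres_refl u : pres_eq u u
| pres_sym u v : pres_eq u v -> pres_eq v u
| pres_trans v u w : pres_eq u v -> pres_eq v w -> pres_eq u w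
| pres_cat u u' v v' :
    pres_eq u u' -> pres_eq v v' -> pres_eq (u ++ v) (u' ++ v')
| pres_cancel x b : pres_eq [:: (x, b); (x, ~~ b)] [::]
| pres_rel u v : R u v -> pres_eq u v.

Definition pres_eqb : rel word := fun u v => `[< pres_eq u v >].

Lemma pres_eqb_refl : reflexive pres_eqb.
Proof. by move=> u; apply/asboolP; apply: pres_refl. Qed.
Lemma pres_eqb_sym : symmetric pres_eqb.
Proof. by move=> u v; apply/asboolP/asboolP; apply: pres_sym. Qed.
Lemma pres_eqb_trans : transitive pres_eqb.
Proof.
by move=> v u w /asboolP uv /asboolP vw; apply/asboolP; apply: pres_trans vw.
Qed.

Canonical pres_equiv :=
  EquivRel pres_eqb pres_eqb_refl pres_eqb_sym pres_eqb_trans.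

Lemma winvK : involutive winv.
Proof.
move=> u; rewrite /winv map_rev revK -map_comp map_id_in // => -[x b] _ /=.
by rewrite negbK.
Qed.

Lemma winv_cat u v : winv (u ++ v) = winv v ++ winv u.
Proof. by rewrite /winv map_cat rev_cat. Qed.

Lemma pres_winvr u : pres_eq (u ++ winv u) [::].
Proof.
elim: u => [|[x b] u IHu]; first exact: pres_refl.
have -> : ((x, b) :: u) ++ winv ((x, b) :: u)
    = ([:: (x, b)] ++ (u ++ winv u)) ++ [:: (x, ~~ b)].
  by rewrite -[in winv _]cat1s winv_cat /= -catA.
apply: pres_trans (pres_cancel x b).
apply: (@pres_cat _ [:: (x, b)]) (pres_refl _).
by apply: (@pres_cat _ [:: (x, b)] _ [::]) IHu; apply: pres_refl.
Qed.

Lemma pres_winvl u : pres_eq (winv u ++ u) [::].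
Proof. by rewrite -{2}[u]winvK; apply: pres_winvr. Qed.

Definition presented : Type := {eq_quot pres_equiv}.
HB.instance Definition _ := Choice.on presented.

Definition pres_class (u : word) : presented := \pi_({eq_quot pres_equiv}) u.
Definition pres_gen (x : X) : presented := pres_class (letter x).

Definition pres_one : presented := pres_class [::].
Definition pres_mul (x y : presented) : presented :=
  pres_class ((repr x : word) ++ (repr y : word)).
Definition pres_inv (x : presented) : presented := pres_class (winv (repr x)).

Lemma pres_classP u v : pres_class u = pres_class v <-> pres_eq u v.
Proof.
split=> [/eqmodP /asboolP //|uv].
by apply/eqmodP/asboolP.
Qed.

Lemma pres_repr u : pres_eq (repr (pres_class u)) u.
Proof. by apply/pres_classP; rewrite /pres_class reprK. Qed.

Lemma pres_classK x : pres_class (repr x) = x.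
Proof. exact: reprK. Qed.

Lemma pres_class_cat u v :
  pres_class (u ++ v) = pres_mul (pres_class u) (pres_class v).
Proof.
by apply/pres_classP; apply: pres_sym; apply: pres_cat; apply: pres_repr.
Qed.

Lemma pres_mulA : associative pres_mul.
Proof.
move=> x y z; rewrite -[x]pres_classK -[y]pres_classK -[z]pres_classK.
by rewrite -!pres_class_cat catA.
Qed.
Lemma pres_mul1 : left_id pres_one pres_mul.
Proof. by move=> x; rewrite -[x in LHS]pres_classK -pres_class_cat pres_classK. Qed.
Lemma pres_mulr1 : right_id pres_one pres_mul.
Proof.
by move=> x; rewrite -[x in LHS]pres_classK -pres_class_cat cats0 pres_classK.
Qed.
Lemma pres_mulV : left_inverse pres_one pres_inv pres_mul.
Proof.
move=> x; rewrite -[x in pres_mul _ x]pres_classK -pres_class_cat.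
exact/pres_classP/pres_winvl.
Qed.
Lemma pres_mulrV : right_inverse pres_one pres_inv pres_mul.
Proof.
move=> x; rewrite -[x in pres_mul x _]pres_classK -pres_class_cat.
exact/pres_classP/pres_winvr.
Qed.

HB.instance Definition _ := isGroup.Build presented
  pres_mulA pres_mul1 pres_mulr1 pres_mulV pres_mulrV.

End Presentation.

Record rootBasis := RootBasis {
  vertex : finType;
  gram : vertex -> vertex -> int;
  gram_sym : forall u v, gram u v = gram v u;
  gram_diag : forall v, gram v v = 2
}.

Section RootSystem.
Variable B : rootBasis.

Definition K0 : zmodType := {ffun vertex B -> int}.

Definition simple_root (v : vertex B) : K0 := [ffun u => (u == v)%:R].

Definition form (x y : K0) : int := \sum_u \sum_v x u * gram u v * y v.

Lemma form_sym x y : form x y = form y x.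
Proof.
rewrite /form exchange_big /=; apply: eq_bigr => v _; apply: eq_bigr => u _.
by rewrite gram_sym mulrC mulrA mulrAC.
Qed.

Lemma formDl x y z : form (x + y) z = form x z + form y z.
Proof.
rewrite /form -big_split; apply: eq_bigr => u _ /=.
by rewrite -big_split; apply: eq_bigr => v _; rewrite ffunE !mulrDl.
Qed.

Lemma formNl x z : form (- x) z = - form x z.
Proof.
rewrite /form -sumrN; apply: eq_bigr => u _; rewrite -sumrN.
by apply: eq_bigr => v _; rewrite ffunE !mulNr.
Qed.

Lemma formMl x n z : form (x *~ n) z = n * form x z.
Proof.
have nat_case (k : nat) : form (x *+ k) z = k%:R * form x z.
  elim: k => [|k IHk]; last by rewrite mulrS formDl IHk mulrS mulrDl mul1r.
  rewrite mulr0n mul0r /form big1 // => u _; rewrite big1 // => v _.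
  by rewrite ffunE !mul0r.
case: n => k; first by rewrite -pmulrn nat_case natz.
by rewrite NegzE mulrNz formNl -pmulrn nat_case natz mulNr.
Qed.

Lemma form_simple u v : form (simple_root u) (simple_root v) = gram u v.
Proof.
rewrite /form (bigD1 u) //= (bigD1 v) //= !big1 => [||i /negPf ni].
- by rewrite !ffunE !eqxx mulr1 mul1r !addr0.
- by move=> i /negPf ni; rewrite big1 // => j _; rewrite ffunE ni !mul0r.
- by rewrite [simple_root v i]ffunE ni mulr0.
Qed.

Definition is_automorphism (f : K0 -> K0) : Prop :=
  [/\ {morph f : x y / x + y}, bijective f
    & forall x y, form (f x) (f y) = form x y].

Definition Aut_pred : pred (K0 -> K0) := fun f => `[< is_automorphism f >].
Definition Aut : Type := {f : K0 -> K0 | Aut_pred f}.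
HB.instance Definition _ := [isSub of Aut for sval].
HB.instance Definition _ := [Choice of Aut by <:].

Definition aut_fun (g : Aut) : K0 -> K0 := val g.
Coercion aut_fun : Aut >-> Funclass.

Lemma autP (g : Aut) : is_automorphism g.
Proof. exact/asboolP/(valP g). Qed.

Lemma aut_ext (g h : Aut) : g =1 h -> g = h.
Proof. by move=> gh; apply/val_inj/funext. Qed.

Definition mk_aut f (fP : is_automorphism f) : Aut := exist _ f (asboolT fP).

Lemma aut_one_subproof : is_automorphism id.
Proof. by split=> //; exists id. Qed.
Definition aut_one : Aut := mk_aut aut_one_subproof.

Lemma aut_mul_subproof (g h : Aut) : is_automorphism (g \o h).
Proof.
have [gD gB gI] := autP g; have [hD hB hI] := autP h; split.
- by move=> x y /=; rewrite hD gD.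
- exact: bij_comp.
- by move=> x y /=; rewrite gI hI.
Qed.
Definition aut_mul g h : Aut := mk_aut (aut_mul_subproof g h).

Lemma aut_inv_exists (g : Aut) : exists h : Aut, cancel g h /\ cancel h g.
Proof.
have [gD [f gf fg] gI] := autP g.
have fP : is_automorphism f.
  split; last by move=> x y; rewrite -gI !fg.
  - by move=> x y; apply: (can_inj gf); rewrite gD !fg.
  - by exists g.
by exists (mk_aut fP).
Qed.
Definition aut_inv g : Aut := sval (cid (aut_inv_exists g)).

Lemma aut_mulA : associative aut_mul.
Proof. by move=> f g h; apply: aut_ext. Qed.
Lemma aut_mul1 : left_id aut_one aut_mul.
Proof. by move=> f; apply: aut_ext. Qed.
Lemma aut_mulr1 : right_id aut_one aut_mul.
Proof. by move=> f; apply: aut_ext. Qed.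
Lemma aut_mulV : left_inverse aut_one aut_inv aut_mul.
Proof.
by move=> f; apply: aut_ext => x; have [fK _] := svalP (cid (aut_inv_exists f)); apply: fK.
Qed.
Lemma aut_mulrV : right_inverse aut_one aut_inv aut_mul.
Proof.
by move=> f; apply: aut_ext => x; have [_ fK] := svalP (cid (aut_inv_exists f)); apply: fK.
Qed.
HB.instance Definition _ := isGroup.Build Aut
  aut_mulA aut_mul1 aut_mulr1 aut_mulV aut_mulrV.

Definition reflection_fun (v : vertex B) (x : K0) : K0 :=
  x - simple_root v *~ form x (simple_root v).

Lemma reflection_subproof v : is_automorphism (reflection_fun v).
Proof.
have formBl x y z : form (x - y) z = form x z - form y z.
  by rewrite formDl formNl.
have rr : form (simple_root v) (simple_root v) = 2.
  by rewrite form_simple gram_diag.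
have rK : involutive (reflection_fun v).
  move=> x; rewrite /reflection_fun formBl formMl rr.
  rewrite -addrA -opprD -mulrzDr; set n := form x _.
  by rewrite [X in _ *~ X](_ : _ = 0) ?mulr0z ?subr0 //; ring.
split.
- by move=> x y; rewrite /reflection_fun formDl mulrzDr opprD addrACA.
- by exists (reflection_fun v).
- move=> x y; rewrite /reflection_fun formBl formMl.
  rewrite !(form_sym _ (_ - _)) !formBl !formMl rr.
  rewrite (form_sym y x) (form_sym (simple_root v) x).
  by rewrite ?(form_sym (simple_root v) y); ring.
Qed.

Definition reflection (v : vertex B) : Aut := mk_aut (reflection_subproof v).

Definition Weyl : groupType :=
  subgroup_generated (fun g : Aut => exists v, g = reflection v).

Definition Weyl_aut (w : Weyl) : Aut := val w.

Record semidirect : Type :=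
  Semidirect { sd_linear : Weyl; sd_translation : K0 }.

Definition sd_to_pair (p : semidirect) : Weyl * K0 :=
  (sd_linear p, sd_translation p).
Definition sd_of_pair (p : Weyl * K0) : semidirect := Semidirect p.1 p.2.
Lemma sd_to_pairK : cancel sd_to_pair sd_of_pair.
Proof. by case. Qed.
HB.instance Definition _ := Choice.copy semidirect (can_type sd_to_pairK).

(* Semidirect w x stands for the affine map y |-> w y + x. *)
Definition sd_one : semidirect := Semidirect 1%g 0.
Definition sd_mul (p q : semidirect) : semidirect :=
  Semidirect (sd_linear p * sd_linear q)%g
    (sd_translation p + Weyl_aut (sd_linear p) (sd_translation q)).
Definition sd_inv (p : semidirect) : semidirect :=
  Semidirect (sd_linear p)^-1%g (- Weyl_aut (sd_linear p)^-1%g (sd_translation p)).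

Lemma autD (g : Aut) : {morph g : x y / x + y}.
Proof. by case: (autP g). Qed.
Lemma aut0 (g : Aut) : g 0 = 0.
Proof. by apply: (addrI (g 0)); rewrite -autD !addr0. Qed.
Lemma autN (g : Aut) : {morph g : x / - x}.
Proof. by move=> x; apply: (addrI (g x)); rewrite -autD !subrr aut0. Qed.

Lemma sd_mulA : associative sd_mul.
Proof.
move=> [f x] [g y] [h z]; rewrite /sd_mul /= mulgA; congr Semidirect.
by rewrite autD addrA.
Qed.
Lemma sd_mul1 : left_id sd_one sd_mul.
Proof. by move=> [f x]; rewrite /sd_mul /= mul1g add0r. Qed.
Lemma sd_mulr1 : right_id sd_one sd_mul.
Proof. by move=> [f x]; rewrite /sd_mul /= mulg1 aut0 addr0. Qed.
Lemma sd_mulV : left_inverse sd_one sd_inv sd_mul.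
Proof. by move=> [f x]; rewrite /sd_mul /= mulVg addNr. Qed.
Lemma sd_mulrV : right_inverse sd_one sd_inv sd_mul.
Proof.
move=> [f x]; rewrite /sd_mul /= mulgV autN; congr Semidirect.
have -> : Weyl_aut f (Weyl_aut f^-1%g x) = x; last by rewrite subrr.
by rewrite -[RHS]/(Weyl_aut 1%g x) -(mulgV f).
Qed.

HB.instance Definition _ := isGroup.Build semidirect
  sd_mulA sd_mul1 sd_mulr1 sd_mulV sd_mulrV.

End RootSystem.

Section Star.
Variables (r : nat) (A : r.-tuple nat).

(* Arm vertices: the pair (i, j) of the 0-based type below is the vertex
   (i + 1, j + 1). *)
Definition arm : finType := {i : 'I_r & 'I_(tnth A i).-1}.
Definition arm_pos (x : arm) : nat := (tagged x).+1.

Definition T_A : finType := option arm.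
Definition T_center : T_A := None.
Definition T_arm (x : arm) : T_A := Some x.

Definition gram_A (u v : T_A) : int :=
  match u, v with
  | None, None => 2
  | None, Some x | Some x, None => if arm_pos x == 1%N then -1 else 0
  | Some x, Some y =>
      if x == y then 2
      else if (tag x == tag y)
                && ((arm_pos y == (arm_pos x).+1) || (arm_pos x == (arm_pos y).+1))
           then -1 else 0
  end.

Lemma gram_A_sym u v : gram_A u v = gram_A v u.
Proof.
by case: u v => [x|] [y|] //=; rewrite eq_sym (eq_sym (tag x)) orbC.
Qed.
Lemma gram_A_diag v : gram_A v v = 2.
Proof. by case: v => [x|] //=; rewrite eqxx. Qed.

Definition R_A : rootBasis := RootBasis gram_A_sym gram_A_diag.

Definition tT_A : finType := option T_A.
Definition tT_star : tT_A := None.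
Definition tT_center : tT_A := Some T_center.
Definition tT_arm (x : arm) : tT_A := Some (T_arm x).

Definition gram_star (v : T_A) : int :=
  match v with
  | None => 2
  | Some x => if arm_pos x == 1%N then -1 else 0
  end.

Definition gram_tA (u v : tT_A) : int :=
  match u, v with
  | None, None => 2
  | None, Some v | Some v, None => gram_star v
  | Some u, Some v => gram_A u v
  end.

Lemma gram_tA_sym u v : gram_tA u v = gram_tA v u.
Proof. by case: u v => [u|] [v|] //=; apply: gram_A_sym. Qed.
Lemma gram_tA_diag v : gram_tA v v = 2.
Proof. by case: v => [v|] //=; apply: gram_A_diag. Qed.

Definition tR_A : rootBasis := RootBasis gram_tA_sym gram_tA_diag.

Local Notation w := (@letter tT_A).
Definition sigma_center : word tT_A := w tT_center ++ w tT_star.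
Definition sigma_arm (x : arm) : word tT_A :=
  w (tT_arm x) ++ sigma_center ++ w (tT_arm x) ++ winv sigma_center.

Local Notation s1 := sigma_center.
Local Notation wa x := (w (tT_arm x)).

Inductive tW_rel : word tT_A -> word tT_A -> Prop :=
| W0 v : tW_rel (w v ++ w v) [::]
| W1_0 u v : gram_tA u v = 0 -> tW_rel (w u ++ w v) (w v ++ w u)
| W1_1 u v : gram_tA u v = -1 ->
    tW_rel (w u ++ w v ++ w u) (w v ++ w u ++ w v)
| W2 x : arm_pos x = 1%N ->
    tW_rel (wa x ++ s1 ++ wa x ++ s1) (s1 ++ wa x ++ s1 ++ wa x)
| W3 x y : arm_pos x = 1%N -> arm_pos y = 1%N -> (tag x < tag y)%N ->
    tW_rel (wa x ++ sigma_arm y) (sigma_arm y ++ wa x)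
| W3' x y : arm_pos x = 1%N -> arm_pos y = 1%N -> (tag x < tag y)%N ->
    tW_rel (wa y ++ sigma_arm x) (sigma_arm x ++ wa y).

Definition W_tT_A : groupType := presented tW_rel.

Definition chi_A : rat := 2 + \sum_(i < r) (1 / (tnth A i)%:R - 1).

Definition is_hyperbolic_extension (E : groupType) : Prop :=
  group_isomorphic E (semidirect R_A)
  /\ nontrivial_central_extension_by_Z E (Weyl tR_A).

End Star.

(* Main.v *)
From HB Require Import structures.
From mathcomp Require Import all_boot all_order all_algebra.
From mathcomp Require Import boolp ring.
Require Import Defs.

Set Implicit Arguments.
Unset Strict Implicit.
Unset Printing Implicit Defensive.

Import Order.TTheory GRing.Theory Num.Theory.
Local Open Scope ring_scope.

(** The group K_0(R_A) >| W(R_A) consists of the affine maps y |-> w y + x of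
    the root lattice.  Let phi send the generator of a tree vertex v to the
    reflection r_v, and the generator of the doubled vertex star to the affine
    reflection y |-> r_1 y - alpha_1.  Then sigma_1 becomes the translation by
    alpha_1, sigma_(i,1) the translation by r_(i,1) alpha_1 - alpha_1 =
    alpha_(i,1), and the defining relations say that translations commute and
    that reflections obey the Coxeter relations of the tree.  So phi is a
    morphism, and it is onto.

    For injectivity, translations are first rebuilt inside the presented group.
    Walking outwards along an arm, tau_n := tau_m ^ w_n / tau_m lifts the
    translation by r_n alpha_m - alpha_m = alpha_n.  Relations (W2) and (W3) say
    that the lifts at the centre and at the first vertices of the arms commute;
    further out, commutation is forced by the braid relations alone
    (leaf_translation).  The tau_v therefore generate an abelian group on which
    the tree generators act as the simple reflections act on the lattice
    (root_transl_conj), and every element is a word in the tree generators times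
    a product of powers of the tau_v (normal_form).  If phi kills such an
    element, the exponents vanish and the word acts trivially on K_0(R_A); the
    geometric representation of a simply laced Coxeter group is faithful
    (prod_word_eq1), so the word is trivial as well.

    For the Weyl group of R~_A, the vector alpha_star - alpha_1 lies in the
    radical of the form, so K_0(R~_A) is K_0(R_A) plus a null line.  An affine
    map (w, x) acts on it by w on the first summand, corrected along the null
    line by the functional - I(w _, x).  This action carries the images under
    phi of the generators to the simple reflections of R~_A, and its kernel
    consists of the translations by the radical of I_(R_A).  A vector orthogonal
    to the arm roots is an affine function of the position on each arm,
    vanishing just past the end, and orthogonality to alpha_1 then reads
    chi_A x_1 = 0 (form_center_chi).  Hence the kernel is trivial if
    chi_A <> 0, and infinite cyclic if chi_A = 0; in that case it is central,
    since W(R_A) fixes the radical.  The extension does not split because the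
    group is generated by involutions, which leaves no room for a nontrivial
    Z-valued correction (no_section_of_involutions). *)

(** * Group morphisms and integer powers *)

Section MultiplicativeMaps.
Variables (G H : groupType) (f : {multiplicative G -> H}).

Lemma multiplicative1 : f 1%g = 1%g.
Proof. by apply: (mulgI (f 1%g)); rewrite -gmulfM !mulg1. Qed.

Lemma multiplicativeV x : f x^-1%g = (f x)^-1%g.
Proof. by apply/esym/mulg1_eq; rewrite -gmulfM mulgV multiplicative1. Qed.

Lemma multiplicative_inj : (forall x, f x = 1%g -> x = 1%g) -> injective f.
Proof.
move=> ker1 x y fxy; apply/divg1_eq/ker1.
by rewrite gmulfM multiplicativeV fxy mulgV.
Qed.

End MultiplicativeMaps.

Section IntegerPowers.
Variable G : groupType.
Implicit Types (g h : G) (m n : int).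

Definition zexpg g n : G :=
  match n with Posz k => (g ^+ k)%g | Negz k => (g ^- k.+1)%g end.

Lemma zexpg_succ g n : zexpg g (n + 1) = (zexpg g n * g)%g.
Proof.
case: n => [k|[|k]]; first by rewrite -PoszD addn1 /= expgSr.
  by rewrite /= mulVg.
have -> : Negz k.+1 + 1 = Negz k by rewrite !NegzE -addn1 PoszD; ring.
by rewrite /= [(g ^+ k.+2)%g]expgS invgM mulgVK.
Qed.

Lemma zexpgD g m n : zexpg g (m + n) = (zexpg g m * zexpg g n)%g.
Proof.
elim: n => [|k IHk|k IHk]; first by rewrite addr0 mulg1.
  by rewrite -addn1 PoszD addrA !zexpg_succ IHk mulgA.
apply: (mulIg g); rewrite -mulgA -!zexpg_succ.
have eqk : - (k.+1%:Z) + 1 = - (k%:Z) by rewrite -addn1 PoszD; ring.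
by rewrite -addrA eqk IHk.
Qed.

Lemma commute_zexpg g h m n :
  commute g h -> commute (zexpg g m) (zexpg h n).
Proof.
move=> gh; have X a b : commute (g ^+ a)%g (h ^+ b)%g by apply: commuteX2.
have V (x y : G) : commute x y -> commute x^-1%g y.
  by move=> xy; apply: commute_sym; apply: commuteV; exact: commute_sym.
case: m n => [a|a] [b|b] /=; first exact: X.
- by apply: commuteV; apply: X.
- by apply: V; apply: X.
- by apply: V; apply: commuteV; apply: X.
Qed.

End IntegerPowers.

(** * Root lattices and simple reflections *)

Section RootLattice.
Variable B : rootBasis.
Local Notation V := (vertex B).
Local Notation alpha := (@simple_root B).
Implicit Types (x y z : K0 B) (u v : V).

Lemma K0_mulrzE x n v : (x *~ n) v = x v * n.
Proof.
have natE k : (x *+ k) v = x v * k%:Z.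
  elim: k => [|k IHk]; first by rewrite ffunE mulr0.
  by rewrite mulrSr ffunE IHk -addn1 PoszD; ring.
case: n => k; first by rewrite -pmulrn natE.
by rewrite NegzE mulrNz ffunE -pmulrn natE mulrN.
Qed.

Lemma K0_addE x y v : (x + y) v = x v + y v. Proof. by rewrite ffunE. Qed.
Lemma K0_oppE x v : (- x) v = - x v. Proof. by rewrite ffunE. Qed.
Lemma simple_rootE u v : alpha u v = (v == u)%:R. Proof. by rewrite ffunE. Qed.
Lemma K0_zeroE v : (0 : K0 B) v = 0. Proof. by rewrite ffunE. Qed.
Definition K0E := (K0_mulrzE, K0_addE, K0_oppE, K0_zeroE).

Lemma K0_expand x : x = \sum_v alpha v *~ x v.
Proof.
apply/ffunP => u; rewrite sum_ffunE (bigD1 u) //= K0_mulrzE ffunE eqxx mul1r.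
by rewrite big1 ?addr0 // => v vu; rewrite K0_mulrzE ffunE eq_sym (negPf vu) mul0r.
Qed.

(** Additive maps are compared with this principle by testing them on the
    simple roots. *)
Lemma K0_ind (P : K0 B -> Prop) :
  P 0 -> (forall v, P (alpha v)) -> (forall x y, P x -> P y -> P (x - y)) ->
  forall x, P x.
Proof.
move=> P0 Pa PB x.
have PN y : P y -> P (- y) by rewrite -(sub0r y); apply: PB.
have PD y z : P y -> P z -> P (y + z).
  by move=> Py Pz; rewrite -(opprK z); apply: PB => //; apply: PN.
rewrite [x]K0_expand; apply: big_ind => // v _.
have Pn k : P (alpha v *~ k%:Z).
  by rewrite -pmulrn; elim: k => [|k IHk]; rewrite ?mulr0n ?mulrS //; apply: PD.
by case: (x v) => k //; rewrite NegzE mulrNz; apply: PN.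
Qed.

Lemma formBl x y z : form (x - y) z = form x z - form y z.
Proof. by rewrite formDl formNl. Qed.
Lemma formDr x y z : form z (x + y) = form z x + form z y.
Proof. by rewrite !(form_sym z) formDl. Qed.
Lemma formMr x n z : form z (x *~ n) = n * form z x.
Proof. by rewrite !(form_sym z) formMl. Qed.

Lemma form_simple_r x u : form x (alpha u) = \sum_v x v * gram v u.
Proof.
rewrite /form; apply: eq_bigr => v _; rewrite (bigD1 u) //= ffunE eqxx mulr1.
by rewrite big1 ?addr0 // => t tu; rewrite ffunE (negPf tu) mulr0.
Qed.

Lemma reflectionE u x : reflection u x = x - alpha u *~ form x (alpha u).
Proof. by []. Qed.

Lemma reflection_simple u v :
  reflection u (alpha v) = alpha v - alpha u *~ gram v u.
Proof. by rewrite reflectionE form_simple. Qed.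

Lemma aut_mulE (g h : Aut B) x : aut_fun (g * h)%g x = g (h x).
Proof. by []. Qed.
Lemma aut_oneE x : aut_fun (1%g : Aut B) x = x.
Proof. by []. Qed.
Lemma autMz (g : Aut B) x n : g (x *~ n) = g x *~ n.
Proof.
have nat k : g (x *+ k) = g x *+ k.
  by elim: k => [|k IHk]; rewrite ?aut0 // !mulrS autD IHk.
by case: n => k; rewrite ?NegzE ?mulrNz ?autN -!pmulrn nat.
Qed.

Lemma reflection_sq u : (reflection u * reflection u)%g = 1%g.
Proof.
apply: aut_ext => x; rewrite aut_mulE aut_oneE !reflectionE.
rewrite formBl formMl form_simple gram_diag -addrA -opprD -mulrzDr.
by rewrite [X in _ *~ X](_ : _ = 0) ?mulr0z ?subr0 //; ring.
Qed.

Lemma reflection_commute u v :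
  gram u v = 0 -> commute (reflection u) (reflection v).
Proof.
move=> uv; apply: aut_ext => x; rewrite !aut_mulE !reflectionE.
rewrite !formBl !formMl !form_simple (gram_sym v u) uv !mulr0 !subr0.
by rewrite addrAC.
Qed.

Lemma reflection_braid u v : gram u v = -1 ->
  (reflection u * (reflection v * reflection u) =
   reflection v * (reflection u * reflection v))%g.
Proof.
move=> uv; apply: aut_ext => x; rewrite !aut_mulE !reflectionE.
rewrite !formBl !formMl !form_simple (gram_sym v u) uv !gram_diag.
apply/ffunP => t.
by rewrite !K0E; ring.
Qed.

End RootLattice.

(** * Faithfulness of the geometric representation *)

Section WordProblem.
Variable B : rootBasis.
Local Notation V := (vertex B).
Local Notation alpha := (@simple_root B).
Hypothesis simply_laced : forall u v : V, u != v -> gram u v = 0 \/ gram u v = -1.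
Variables (G : groupType) (s : V -> G) (rho : {multiplicative G -> Aut B}).
Hypothesis s_sq : forall v, (s v * s v = 1)%g.
Hypothesis s_commute : forall u v, gram u v = 0 -> commute (s u) (s v).
Hypothesis s_braid : forall u v, gram u v = -1 ->
  (s u * (s v * s u) = s v * (s u * s v))%g.
Hypothesis rho_s : forall v, rho (s v) = reflection v.

Definition prod_word (u : seq V) : G := (\prod_(v <- u) s v)%g.

Lemma prod_word_rcons u v : prod_word (rcons u v) = (prod_word u * s v)%g.
Proof. by rewrite /prod_word -cats1 big_cat /= big_seq1. Qed.

Definition nonneg (x : K0 B) := forall v, 0 <= x v.

(** Deodhar's dichotomy: unless the word w carries the simple root t into the
    positive cone, w t can be shortened in G.  In the simply laced case a plain
    induction on the length suffices: compare the last letter a of w = u a with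
    t, and use the induction hypothesis on u, or on a shorter word for u a or
    u t, in the dihedral group of order 4 or 6 generated by a and t.  A word
    that turns out not to be reduced is replaced by a shorter one. *)
Lemma nonneg_or_shorter (w : seq V) t :
  nonneg (aut_fun (rho (prod_word w)) (alpha t)) \/
  exists2 w', (size w' < size w)%N & prod_word w' = (prod_word w * s t)%g.
Proof.
have [n] := ubnP (size w); elim: n w t => // n IH w t.
case/lastP: w => [|u a] ltn.
  by left=> v; rewrite /prod_word big_nil multiplicative1 aut_oneE ffunE ler0n.
rewrite size_rcons ltnS in ltn *; rewrite prod_word_rcons.
have [<-{t}|neq] := eqVneq a t.
  by right; exists u; rewrite // -mulgA s_sq mulg1.
have rhoM g h x :
    aut_fun (rho (g * h)%g) x = aut_fun (rho g) (aut_fun (rho h) x).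
  by rewrite gmulfM.
have := simply_laced neq; case=> at0.
  (* a fixes the root t and commutes with it: only u matters. *)
  rewrite rhoM rho_s reflection_simple gram_sym at0 mulr0z subr0.
  have [//|[u' ltu' eu']] := IH u t ltn; first by left.
  right; exists (rcons u' a); first by rewrite size_rcons.
  by rewrite prod_word_rcons eu' -!mulgA (s_commute at0).
rewrite rhoM rho_s reflection_simple gram_sym at0 mulrN1z opprK autD.
(* Now a maps the root t to the sum of both roots. *)
have [pos_a|[u' ltu' eu']] := IH u a ltn; last first.
  (* w = u a itself shortens to u'. *)
  have [|pos|[u'' ltu'' eu'']] := IH u' t; first exact: leq_trans ltu' (ltnW ltn).
    left; move: pos; rewrite eu' rhoM rho_s reflection_simple.
    by rewrite gram_sym at0 mulrN1z opprK autD.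
  right; exists u''; first by apply: leqW; apply: ltn_trans ltu'' ltu'.
  by rewrite eu'' eu'.
have [pos_t|[u' ltu' eu']] := IH u t ltn.
  by left=> v; rewrite ffunE addr_ge0.
(* Here u = u' t, so w t = u' (t a t) = u' (a t a), while w sends the root t
   to the image of the root a under u'. *)
have eu : prod_word u = (prod_word u' * s t)%g by rewrite eu' -mulgA s_sq mulg1.
have [|pos|[u'' ltu'' eu'']] := IH u' a; first exact: leq_trans ltu' (ltnW ltn).
  have ta : reflection t (alpha t + alpha a) = alpha a.
    rewrite autD !reflection_simple at0 gram_diag mulrN1z opprK.
    by apply/ffunP => v; rewrite !K0E; ring.
  by left; rewrite -autD eu rhoM rho_s ta.
right; exists (rcons (rcons u'' t) a).
  by rewrite !size_rcons; apply: leq_ltn_trans ltu'' ltu'.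
rewrite !prod_word_rcons eu'' eu -!mulgA; congr (_ * _)%g.
exact: s_braid.
Qed.

(** A nonempty word u t acting trivially has u sending the simple root t to its
    negative, so by the dichotomy it equals a shorter word, which still acts
    trivially. *)
Lemma prod_word_eq1 (w : seq V) : rho (prod_word w) = 1%g -> prod_word w = 1%g.
Proof.
have [n] := ubnP (size w); elim: n w => // n IH w.
case/lastP: w => [_ _|u t]; first by rewrite /prod_word big_nil.
rewrite size_rcons ltnS => ltn rho1.
have eu : (prod_word u = prod_word (rcons u t) * s t)%g.
  by rewrite prod_word_rcons -mulgA s_sq mulg1.
have [pos|[w' ltw' ew']] := nonneg_or_shorter u t.
  have /(_ t) := pos; rewrite eu gmulfM rho1 mul1g rho_s reflection_simple.
  by rewrite gram_diag !K0E simple_rootE eqxx.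
rewrite -prod_word_rcons in ew'; rewrite -ew' in rho1 *.
by apply: IH rho1; apply: leq_trans ltw' (ltnW ltn).
Qed.

End WordProblem.

(** * Presented groups *)

Section Presentations.
Variables (X : choiceType) (R : word X -> word X -> Prop).
Local Open Scope group_scope.

Local Notation class := (@pres_class X R : word X -> presented R).
Local Notation gen := (@pres_gen X R : X -> presented R).

Lemma pres_class_mul u v : class (u ++ v) = class u * class v.
Proof. exact: pres_class_cat. Qed.

Lemma pres_class_nil : class [::] = 1. Proof. by []. Qed.

Lemma pres_class_winv u : class (winv u) = (class u)^-1.
Proof.
apply/esym/mulg1_eq; rewrite -pres_class_mul -pres_class_nil.
by apply/pres_classP; apply: pres_winvr.
Qed.

Lemma pres_class_letter x : class (letter x) = gen x. Proof. by []. Qed.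

Definition pres_classE :=
  (pres_class_mul, pres_class_winv, pres_class_letter, pres_class_nil).

Lemma pres_ind (P : presented R -> Prop) :
  P 1 -> (forall x g, P g -> P (gen x * g)) ->
  (forall x g, P g -> P ((gen x)^-1 * g)) -> forall g, P g.
Proof.
move=> P1 PM PV g; rewrite -[g]pres_classK.
elim: (repr g : word X) => [//|[x b] u IHu].
rewrite -[_ :: u]cat1s pres_class_mul; case: b; last exact: PM.
have -> : [:: (x, true)] = winv (letter x) by [].
by rewrite pres_class_winv; apply: PV.
Qed.

Section Lift.
Variables (H : groupType) (f : X -> H).

Definition word_val (u : word X) : H :=
  \prod_(l <- u) (if l.2 then (f l.1)^-1 else f l.1).

Lemma word_val_cat u v : word_val (u ++ v) = word_val u * word_val v.
Proof. exact: big_cat. Qed.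

Lemma word_val_letter x : word_val (letter x) = f x.
Proof. exact: big_seq1. Qed.

Lemma word_val_nil : word_val [::] = 1.
Proof. exact: big_nil. Qed.

Lemma word_val_winv u : word_val (winv u) = (word_val u)^-1.
Proof.
rewrite /word_val /winv; elim: u => [|[x b] u IHu]; first by rewrite !big_nil invg1.
rewrite /= rev_cons -cats1 big_cat IHu !big_cons big_nil /= mulg1 invgM.
by case: b; rewrite /= ?invgK.
Qed.

Definition word_valE :=
  (word_val_cat, word_val_winv, word_val_letter, word_val_nil).

Hypothesis fR : forall u v, R u v -> word_val u = word_val v.

Lemma word_val_pres_eq u v : pres_eq R u v -> word_val u = word_val v.
Proof.
elim=> {u v} [//|//|v u w _ -> _ -> //|u u' v v' _ eu _ ev|x b|u v /fR //].
  by rewrite !word_val_cat eu ev.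
rewrite /word_val big_cons big_seq1 big_nil /=.
by case: b; rewrite /= ?mulgV ?mulVg.
Qed.

Lemma pres_lift_exists :
  exists F : {multiplicative presented R -> H}, forall x, F (gen x) = f x.
Proof.
pose F (g : presented R) := word_val (repr g : word X).
have Fclass u : F (class u) = word_val u.
  exact/word_val_pres_eq/pres_repr.
have FM : {morph F : g h / g * h}.
  move=> g h; rewrite -[g]pres_classK -[h]pres_classK -pres_class_mul !Fclass.
  exact: word_val_cat.
pose FF : {multiplicative presented R -> H} :=
  HB.pack F (isMultiplicative.Build _ _ F FM).
by exists FF => x; rewrite /= Fclass word_val_letter.
Qed.

End Lift.
End Presentations.

(** * Translations along a chain of reflections *)

Section Conjugation.
Variables (G : groupType).
Local Open Scope group_scope.
Implicit Types s x y z : G.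

Lemma commute_conj x y z : commute x y -> commute (x ^ z) (y ^ z).
Proof. by rewrite /commute -!conjMg => ->. Qed.

Lemma conj_commute x s : commute x s -> x ^ s = x.
Proof. by move=> xs; rewrite conjgE xs mulKg. Qed.

Lemma conj_fix_commute x s : x ^ s = x -> commute x s.
Proof. by move=> xs; rewrite /commute conjgC xs. Qed.

Lemma commute_conjr x y s : commute x y -> commute x s -> commute x (y ^ s).
Proof.
by move=> xy xs; rewrite -[x](conj_commute xs); apply: commute_conj.
Qed.

(** Growing a translation lattice by a leaf n attached to m, where p is another
    neighbour of m.  The element E = tp ^ (sm sn) stands for the translation by
    alpha_p + alpha_m + alpha_n.  It commutes with sm, because
    (sm sn) sm = sn (sm sn) and sn fixes tp; it commutes with tp, hence also with
    tp ^ sm = tp tm, hence with tm.  As tm ^ sn = tp^-1 E, that element commutes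
    with tm, which is what the leaf has to satisfy. *)
Lemma leaf_translation (sm sn tp tm : G) :
  sn * sn = 1 -> sn * (sm * sn) = sm * (sn * sm) ->
  commute tp sn -> commute tp tm ->
  tp ^ sm = tp * tm -> tm ^ sm = tm^-1 ->
  let tn := tm ^ sn / tm in
  [/\ commute (tm ^ sn) tm, tm ^ sn = tm * tn,
      tn ^ sm = tn * tm & tn ^ sn = tn^-1].
Proof.
move=> sn2 braid tp_sn tp_tm tpm tmm tn.
have tpX : commute tp (tm ^ sn) by apply: commute_conjr.
have eE : tp ^ (sm * sn) = tp * tm ^ sn.
  by rewrite conjgM tpm conjMg (conj_commute tp_sn).
have E_sm : commute (tp ^ (sm * sn)) sm.
  apply: conj_fix_commute; rewrite -conjgM -mulgA -braid conjgM.
  by rewrite (conj_commute tp_sn).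
have X_tm : commute (tm ^ sn) tm.
  have E_tp : commute (tp ^ (sm * sn)) tp.
    by rewrite eE; apply: commute_sym; apply: commuteM.
  have E_tm : commute (tp ^ (sm * sn)) tm.
    have -> : tm = tp^-1 * tp ^ sm by rewrite tpm mulKg.
    by apply: commuteM; [apply: commuteV | apply: commute_conjr].
  have -> : tm ^ sn = tp^-1 * tp ^ (sm * sn) by rewrite eE mulKg.
  apply: commute_sym; apply: commuteM; last exact: commute_sym.
  by apply: commuteV; apply: commute_sym.
have X_sm : (tm ^ sn) ^ sm = tp^-1 ^ sm * tp * tm ^ sn.
  rewrite -[X in X ^ sm](mulKg tp) -eE conjMg (conj_commute E_sm) eE.
  by rewrite mulgA.
split=> //.
- by rewrite /tn mulgA -X_tm mulgK.
- rewrite /tn conjMg X_sm conjVg tpm conjVg tmm invgK invgM !mulgVK.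
  by rewrite -mulgA X_tm mulKg.
- rewrite /tn conjMg conjVg -conjgM sn2 conjg1.
  by rewrite invgF.
Qed.

(** The reflection at the centre acts on the translation of the first arm
    vertex: with sigma = a b this says that sigma ^ (x a) sigma = sigma ^ x,
    a consequence of the two braid relations of x. *)
Lemma braid_commutator_conj (a x b : G) :
  a * a = 1 -> x * x = 1 -> b * b = 1 ->
  x * (a * x) = a * (x * a) -> x * (b * x) = b * (x * b) ->
  ((a * b) ^ x) ^ a * (a * b) = (a * b) ^ x.
Proof.
move=> a2 x2 b2 ax bx; rewrite !conjgE !(mulg1_eq a2, mulg1_eq x2).
transitivity (a * (x * a) * (b * (x * b))).
  by rewrite -!mulgA (mulgA a a b) a2 mul1g.
by rewrite -ax -bx -!mulgA (mulgA x x) x2 mul1g.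
Qed.

End Conjugation.

Section Chain.
Variables (G : groupType).
Local Open Scope group_scope.
Variables (b : G) (s : nat -> G) (n : nat).

(** Here s 0 is the centre, b its double, and s 1, ..., s n are the vertices of
    one arm.  The k-th element lifts the translation by the k-th simple root,
    which is the difference of the (k-1)-st root and its reflection in the
    k-th. *)
Fixpoint chain_transl (k : nat) : G :=
  if k is k'.+1 then chain_transl k' ^ s k / chain_transl k' else s 0 * b.
Local Notation t := chain_transl.

(** The k-th translation is a word in the m-th one and the generators strictly
    after m, up to k. *)
Lemma chain_transl_commute_from z m k : (m <= k)%N ->
  commute z (t m) -> (forall j, (m < j <= k)%N -> commute z (s j)) ->
  commute z (t k).
Proof.
move=> mk zm zs.
suff tD d : (d + m <= k)%N -> commute z (t (d + m)).
  by rewrite -(subnK mk); apply: tD; rewrite subnK.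
elim: d => [//|d IHd] le_k; rewrite addSn /=.
have zd := IHd (ltnW le_k).
have zsd : commute z (s (d + m).+1).
  by apply: zs; rewrite ltnS leq_addl.
apply: commuteM; last exact: commuteV.
exact: commute_conjr.
Qed.

Hypothesis s_sq : forall k, (k <= n)%N -> s k * s k = 1.
Hypothesis b_sq : b * b = 1.
Hypothesis s_braid : forall k, (k < n)%N ->
  s k.+1 * (s k * s k.+1) = s k * (s k.+1 * s k).
Hypothesis s_commute : forall j k, (j.+1 < k)%N -> (k <= n)%N ->
  commute (s j) (s k).
Hypothesis b_braid : (0 < n)%N -> s 1 * (b * s 1) = b * (s 1 * b).
Hypothesis b_commute : forall k, (1 < k <= n)%N -> commute b (s k).
Hypothesis s_sigma : (0 < n)%N ->
  s 1 * (t 0 * (s 1 * t 0)) = t 0 * (s 1 * (t 0 * s 1)).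

Lemma chain_gen_inv k : (k <= n)%N -> (s k)^-1 = s k.
Proof. by move=> /s_sq /mulg1_eq. Qed.

Lemma center_transl_conj : t 0 ^ s 0 = (t 0)^-1.
Proof.
rewrite /= conjgE invgM chain_gen_inv // mulgA (mulg1_eq b_sq) mulgA.
by rewrite s_sq // mul1g.
Qed.

Lemma chain_transl_commute_far i k :
  (i.+1 < k)%N -> (k <= n)%N -> commute (t i) (s k).
Proof.
move=> ik kn; apply: commute_sym.
apply: (@chain_transl_commute_from _ 0%N) => // [|j /andP [_ ji]].
  apply: commuteM; first by apply/commute_sym/s_commute => //; apply: leq_trans ik.
  by apply/commute_sym/b_commute; rewrite kn (leq_trans _ ik).
by apply/commute_sym/s_commute => //; apply: leq_trans ik.
Qed.

(** The action of adjacent generators on adjacent translations.  At the start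
    of the chain it rests on the relation s_sigma between s 1 and the
    translation at the centre; further on it is the leaf extension step. *)
Lemma chain_local k : (k < n)%N ->
  [/\ commute (t k ^ s k.+1) (t k), t k ^ s k.+1 = t k * t k.+1,
      t k.+1 ^ s k = t k.+1 * t k & t k.+1 ^ s k.+1 = (t k.+1)^-1].
Proof.
elim: k => [n_gt0|k IHk kn].
  have sX : commute (t 0 ^ s 1) (t 0).
    rewrite /commute conjgE chain_gen_inv //; move: (s_sigma n_gt0).
    by move: (t 0) => x; rewrite !mulgA.
  split=> //.
  - by rewrite [t 1]/= mulgA -sX mulgK.
  - have s1 := braid_commutator_conj (s_sq (leq0n n)) (s_sq n_gt0) b_sq
      (s_braid n_gt0) (b_braid n_gt0).
    move: center_transl_conj s1; rewrite [t 1]/= -[s 0 * b]/(t 0).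
    by move: (t 0) => y y0 y1; rewrite conjMg conjVg y0 invgK y1 mulgVK.
  - rewrite [t 1]/= -[s 0 * b]/(t 0); move: (t 0) => y.
    by rewrite conjMg conjVg -conjgM s_sq // conjg1 invgF.
have [X1 c1 d1 e1] := IHk (ltnW kn).
have ck : commute (t k) (t k.+1).
  apply: commuteM; first exact: commute_sym.
  exact: commuteV.
apply: leaf_translation ck c1 e1; [exact: s_sq|exact: s_braid|].
exact: chain_transl_commute_far.
Qed.

Lemma chain_transl_commute_near k : (k < n)%N -> commute (t k.+1) (t k).
Proof.
move=> /chain_local [X _ _ _]; apply/commute_sym/commuteM.
  exact: commute_sym.
exact: commuteV.
Qed.

(** It suffices to treat k = i + 2.  There conjugation by s i multiplies
    t (i + 1) by t i, and the extra factor cancels in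
    t (i + 1) ^ s (i + 2) / t (i + 1) because t i commutes with s (i + 2). *)
Lemma chain_transl_commute_back i k :
  (i.+1 < k)%N -> (k <= n)%N -> commute (t k) (s i).
Proof.
move=> ik kn; apply: commute_sym.
apply: (@chain_transl_commute_from _ i.+2) => // [|j /andP [ij jk]]; last first.
  by apply: s_commute; [apply: ltnW | apply: leq_trans jk kn].
have i2n : (i.+2 <= n)%N by apply: leq_trans kn.
have [_ _ d _] := chain_local (ltnW i2n).
apply/commute_sym/conj_fix_commute.
have si : commute (s i.+2) (s i) by apply/commute_sym/s_commute.
have -> : t i.+2 ^ s i = (t i.+1 ^ s i) ^ s i.+2 / (t i.+1 ^ s i).
  by rewrite [t i.+2]/= conjMg -!conjgM si conjVg.
rewrite d conjMg (conj_commute (chain_transl_commute_far (ltnSn _) i2n)).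
by rewrite invgM mulgA mulgK.
Qed.

Lemma chain_transl_commute i k : (i <= n)%N -> (k <= n)%N -> commute (t i) (t k).
Proof.
wlog ik : i k / (i <= k)%N => [wl|].
  by move=> in_ kn; case/orP: (leq_total i k) => h; [|apply: commute_sym]; apply: wl.
move=> _ kn; have [<-//|lt_ik] := eqVneq i k.
have {lt_ik}ik : (i < k)%N by rewrite ltn_neqAle lt_ik.
apply: (@chain_transl_commute_from _ i.+1) => // [|j /andP [ij jk]].
  by apply/commute_sym/chain_transl_commute_near; apply: leq_trans kn.
by apply: chain_transl_commute_far => //; apply: leq_trans jk kn.
Qed.

End Chain.

(** * Translation lattices and the semi-direct product *)

Section LatticeMorphism.
Variables (B : rootBasis) (G : groupType) (tau : vertex B -> G).
Hypothesis tauC : forall u v, commute (tau u) (tau v).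
Local Notation alpha := (@simple_root B).
Local Open Scope group_scope.

Definition lattice_transl (x : K0 B) : G :=
  \prod_(v : vertex B) zexpg (tau v) (x v).

Lemma translD x y : lattice_transl (x + y)%R = lattice_transl x * lattice_transl y.
Proof.
rewrite /lattice_transl -prodgM_commute => [|u v _ _]; last exact: commute_zexpg.
by apply: eq_bigr => v _; rewrite K0_addE zexpgD.
Qed.

Lemma transl0 : lattice_transl 0%R = 1.
Proof. by apply: (mulgI (lattice_transl 0%R)); rewrite -translD addr0 mulg1. Qed.

Lemma translN x : lattice_transl (- x)%R = (lattice_transl x)^-1.
Proof. by apply/esym/mulg1_eq; rewrite -translD subrr transl0. Qed.

Lemma transl_simple v n : lattice_transl (alpha v *~ n)%R = zexpg (tau v) n.
Proof.
rewrite /lattice_transl (eq_bigr (fun u => if u == v then zexpg (tau v) n else 1)).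
  by rewrite -big_mkcond big_pred1_eq.
move=> u _; rewrite K0_mulrzE simple_rootE.
by have [->|_] := eqVneq u v; rewrite ?mul1r ?mul0r.
Qed.

(** Both sides are additive in x, so the action on the lattice of translations
    is determined by the action on the translations by simple roots. *)
Lemma transl_conj (s : G) u :
  (forall v, tau v ^ s = tau v * zexpg (tau u) (- gram v u)%R) ->
  forall x, lattice_transl x ^ s = lattice_transl (reflection u x).
Proof.
move=> taus; apply: K0_ind => [|v|x y ex ey].
- by rewrite aut0 transl0 conj1g.
- rewrite reflection_simple -mulrNz translD transl_simple -[alpha v]mulr1z.
  by rewrite transl_simple; apply: taus.
- by rewrite autD autN (translD x) (translD (reflection u x)) !translN
     conjMg conjVg ex ey.
Qed.

End LatticeMorphism.

Section Semidirect.
Variable B : rootBasis.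
Local Open Scope group_scope.

Lemma Weyl_inj : injective (@Weyl_aut B).
Proof. exact: val_inj. Qed.

Lemma Weyl_autM (f g : Weyl B) :
  Weyl_aut (f * g) = Weyl_aut f * Weyl_aut g.
Proof. exact: valM. Qed.

Lemma Weyl_aut1 : Weyl_aut (1 : Weyl B) = 1.
Proof. by apply: (mulgI (Weyl_aut 1)); rewrite -Weyl_autM !mulg1. Qed.

Lemma generated_reflection (u : vertex B) :
  generated (fun g : Aut B => exists v, g = reflection v) (reflection u).
Proof. by apply: generated_sub; exists u. Qed.

Definition Weyl_reflection (u : vertex B) : Weyl B :=
  exist _ (reflection u) (generated_reflection u).

Lemma Weyl_reflectionE u : Weyl_aut (Weyl_reflection u) = reflection u.
Proof. by []. Qed.

Lemma Weyl_ind (P : Aut B -> Prop) :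
  P 1 -> (forall g h, P g -> P h -> P (g / h)) ->
  (forall u, P (reflection u)) -> forall w : Weyl B, P (Weyl_aut w).
Proof.
move=> P1 PD Pr w; have /asboolP gw := valP w; apply/asboolP.
apply: (gw (fun g => `[< P g >])) => [|_ [u ->]]; last exact/asboolP.
split=> [|g h /asboolP Pg /asboolP Ph]; apply/asboolP => //.
exact: PD.
Qed.

Lemma sd_mulE (p q : semidirect B) : p * q = sd_mul p q. Proof. by []. Qed.
Definition sd_transl (x : K0 B) : semidirect B := Semidirect 1 x.
Definition sd_refl (u : vertex B) (x : K0 B) : semidirect B :=
  Semidirect (Weyl_reflection u) x.

Lemma sd_translM x y : sd_transl x * sd_transl y = sd_transl (x + y)%R.
Proof. by rewrite sd_mulE /sd_mul /= mulg1 Weyl_aut1. Qed.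

Lemma sd_translV x : (sd_transl x)^-1 = sd_transl (- x)%R.
Proof. by apply: mulg1_eq; rewrite sd_translM subrr. Qed.

Lemma sd_transl_commute x y : commute (sd_transl x) (sd_transl y).
Proof. by rewrite /commute !sd_translM addrC. Qed.

Lemma Weyl_reflection_sq u : Weyl_reflection u * Weyl_reflection u = 1.
Proof. by apply: Weyl_inj; rewrite Weyl_autM reflection_sq Weyl_aut1. Qed.

Lemma sd_refl_mul u v x y :
  sd_refl u x * sd_refl v y =
  Semidirect (Weyl_reflection u * Weyl_reflection v) (x + reflection u y)%R.
Proof. by []. Qed.

Lemma sd_refl_sq u : sd_refl u 0%R * sd_refl u 0%R = 1.
Proof. by rewrite sd_refl_mul Weyl_reflection_sq aut0 addr0. Qed.

Lemma sd_transl_conj u x : sd_transl x ^ sd_refl u 0%R = sd_transl (reflection u x).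
Proof.
rewrite conjgE (mulg1_eq (sd_refl_sq u)) sd_mulE /sd_mul /=.
by rewrite mul1g Weyl_reflection_sq Weyl_aut1 aut0 addr0 add0r.
Qed.

End Semidirect.

(** * The affine representation of the presented group *)

(** The shape of (W2): s commutes with its conjugate by the involution a. *)
Lemma involution_conj_commute (G : groupType) (a c b s : G) :
  (c * b = s -> a * a = 1 -> commute (s ^ a) s ->
  a * (c * b * (a * (c * b))) = c * b * (a * (c * b * a)))%g.
Proof.
by move=> -> a2; rewrite /commute conjgE (mulg1_eq a2) -!mulgA.
Qed.

Section StarGroup.
Variables (r : nat) (A : r.-tuple nat).
Local Open Scope group_scope.
Local Notation G := (W_tT_A A).
Local Notation arm := (arm A).
Local Notation gen := (@pres_gen (tT_A A) (@tW_rel r A) : tT_A A -> G).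
Local Notation alpha := (@simple_root (R_A A)).
Local Notation center := (T_center A : vertex (R_A A)).
Local Notation arm_vertex x := (T_arm x : vertex (R_A A)).
Local Notation star := (tT_star A).
Implicit Types (x y : arm) (u v : tT_A A).

(** The roots of star and of the centre differ by a vector of the radical, so the
    doubled vertex has the centre as its linear shadow: the Gram matrix of the
    extended tree is pulled back along this map. *)
Definition shadow v : vertex (R_A A) := odflt center v.

Lemma gram_tAE u v : gram_tA u v = gram (shadow u) (shadow v).
Proof. by case: u v => [[x|]|] [[y|]|]. Qed.

Lemma arm_eqE x y : (x == y) = (tag x == tag y) && (arm_pos x == arm_pos y).
Proof.
case: eqP => [->|neq]; first by rewrite !eqxx.
apply/esym/negbTE/negP => /andP [/eqP xy /eqP [pos_xy]]; apply: neq.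
case: x y xy pos_xy => [i k] [j l] /= ij; case: _ / ij l => l kl.
by congr existT; apply: val_inj.
Qed.

Lemma gram_arms_far x y : tag x != tag y -> gram (arm_vertex x) (arm_vertex y) = 0%R.
Proof. by move=> /negPf xy; rewrite /= arm_eqE xy. Qed.

(** The sign makes the centre followed by its double act as the translation by
    plus the central root. *)
Definition affine_shift v : int := if v is None then (-1)%R else 0%R.
Definition affine_gen v : semidirect (R_A A) :=
  sd_refl (shadow v) (alpha (shadow v) *~ affine_shift v)%R.

Lemma affine_gen_sq v : affine_gen v * affine_gen v = 1.
Proof.
rewrite sd_refl_mul Weyl_reflection_sq autMz reflection_simple gram_diag.
rewrite -mulrzDl (_ : _ + _ = 0)%R ?mul0rz //.
by apply/ffunP => t; rewrite !K0E; ring.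
Qed.

Lemma affine_gen_commute u v :
  gram_tA u v = 0%R -> commute (affine_gen u) (affine_gen v).
Proof.
rewrite gram_tAE => uv; rewrite /commute !sd_refl_mul !autMz !reflection_simple.
rewrite [gram (shadow v) _]gram_sym uv !mulr0z !subr0 addrC.
congr Semidirect; apply: Weyl_inj; rewrite !Weyl_autM.
exact: reflection_commute.
Qed.

Lemma affine_gen_braid u v : gram_tA u v = (-1)%R ->
  affine_gen u * (affine_gen v * affine_gen u) =
  affine_gen v * (affine_gen u * affine_gen v).
Proof.
rewrite gram_tAE => uv; rewrite !sd_refl_mul !sd_mulE /sd_mul /=.
congr Semidirect.
  by apply: Weyl_inj; rewrite !Weyl_autM; apply: reflection_braid.
rewrite !Weyl_reflectionE !(autMz, autD, reflection_simple, autN).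
rewrite !gram_diag [gram (shadow v) _]gram_sym uv.
by apply/ffunP => t; rewrite !K0E; ring.
Qed.

Lemma affine_gen_sigma :
  affine_gen (tT_center A) * affine_gen star = sd_transl (alpha center).
Proof.
rewrite sd_refl_mul Weyl_reflection_sq mulr0z add0r mulrN1z autN.
rewrite reflection_simple gram_diag; congr Semidirect.
by apply/ffunP => t; rewrite !K0E; ring.
Qed.

Lemma affine_gen_arm x :
  affine_gen (tT_arm x) = sd_refl (arm_vertex x) 0%R.
Proof. by rewrite /affine_gen mulr0z. Qed.

Lemma affine_gen_inv v : (affine_gen v)^-1 = affine_gen v.
Proof. exact/mulg1_eq/affine_gen_sq. Qed.

(** The commutator of w_(i,1) with a translation by the central root is the
    translation by r_(i,1) alpha_1 - alpha_1. *)
Lemma word_val_sigma_arm x : arm_pos x = 1%N ->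
  word_val affine_gen (sigma_arm x) = sd_transl (alpha (arm_vertex x)).
Proof.
move=> x1; rewrite !word_valE affine_gen_sigma.
set sg := sd_transl _; set w := affine_gen _.
have -> : w * (sg * (w * sg^-1)) = sg ^ w / sg.
  by rewrite conjgE affine_gen_inv -!mulgA.
rewrite /w affine_gen_arm sd_transl_conj reflection_simple sd_translV sd_translM.
rewrite (_ : gram _ _ = -1)%R /= ?x1 // mulrN1z opprK addrC addKr //.
Qed.

(** The relations not of Coxeter type hold because translations commute (W2)
    and because a reflection fixes the translation by an orthogonal root
    (W3). *)
Lemma affine_gen_rel (p q : word (tT_A A)) :
  tW_rel p q -> word_val affine_gen p = word_val affine_gen q.
Proof.
have far x y : tag x != tag y ->
    affine_gen (tT_arm x) * sd_transl (alpha (arm_vertex y)) =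
    sd_transl (alpha (arm_vertex y)) * affine_gen (tT_arm x).
  move=> /gram_arms_far xy; apply/esym/conj_fix_commute.
  rewrite affine_gen_arm sd_transl_conj reflection_simple.
  by rewrite gram_sym xy mulr0z subr0.
case=> {p q} [v|u v uv|u v uv|x x1|x y x1 y1 xy|x y x1 y1 xy];
  last first.
- rewrite (word_val_cat _ (letter (tT_arm y))) (word_val_cat _ (sigma_arm x)).
  by rewrite word_val_letter word_val_sigma_arm // far // neq_ltn xy orbT.
- rewrite (word_val_cat _ (letter (tT_arm x))) (word_val_cat _ (sigma_arm y)).
  by rewrite word_val_letter word_val_sigma_arm // far // neq_ltn xy.
all: rewrite !word_valE.
- apply: involution_conj_commute affine_gen_sigma (affine_gen_sq _) _.
  by rewrite affine_gen_arm sd_transl_conj; apply: sd_transl_commute.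
- exact: affine_gen_braid.
- exact: affine_gen_commute.
- exact: affine_gen_sq.
Qed.

Lemma affine_morphism_exists :
  exists phi : {multiplicative G -> semidirect (R_A A)},
  forall v, phi (gen v) = affine_gen v.
Proof. exact: pres_lift_exists affine_gen_rel. Qed.

(** * Lifting the translation lattice to the presented group *)

Lemma gen_sq v : gen v * gen v = 1.
Proof. by have /pres_classP := pres_rel (W0 v); rewrite !pres_classE. Qed.

Lemma gen_inv v : (gen v)^-1 = gen v.
Proof. exact/mulg1_eq/gen_sq. Qed.

Lemma gen_commute u v : gram_tA u v = 0%R -> commute (gen u) (gen v).
Proof.
by move=> uv; have /pres_classP := pres_rel (W1_0 uv); rewrite !pres_classE.
Qed.

Lemma gen_braid u v : gram_tA u v = (-1)%R ->
  gen u * (gen v * gen u) = gen v * (gen u * gen v).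
Proof.
by move=> uv; have /pres_classP := pres_rel (W1_1 uv); rewrite !pres_classE.
Qed.

(** Position 0 on every arm is the centre; the value 1 past the end of the arm
    is a filler. *)
Definition arm_gen (i : 'I_r) (k : nat) : G :=
  if k is k'.+1 then
    oapp (fun o : 'I_(tnth A i).-1 => gen (tT_arm (Tagged _ o : arm))) 1 (insub k')
  else gen (tT_center A).

Lemma arm_genE x : arm_gen (tag x) (arm_pos x) = gen (tT_arm x).
Proof. by case: x => i o; rewrite /arm_gen /= valK. Qed.

Lemma arm_at (i : 'I_r) k : (k < (tnth A i).-1)%N ->
  exists2 x : arm, tag x = i & arm_pos x = k.+1.
Proof. by move=> ki; exists (Tagged (fun j => 'I_(tnth A j).-1) (Ordinal ki)). Qed.

Local Notation ctransl i := (chain_transl (gen star) (arm_gen i)).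

Lemma arm_gen_sq i k : (k <= (tnth A i).-1)%N -> arm_gen i k * arm_gen i k = 1.
Proof.
case: k => [_|k /arm_at [x <- <-]]; first exact: gen_sq.
rewrite arm_genE; exact: gen_sq.
Qed.

Lemma gram_arm_near x y : tag x = tag y -> arm_pos y = (arm_pos x).+1 ->
  gram (arm_vertex x) (arm_vertex y) = (-1)%R.
Proof.
move=> xy pos; rewrite /= arm_eqE xy pos !eqxx /=.
by rewrite -{1}[arm_pos x]addn0 -addn1 eqn_add2l.
Qed.

Lemma gram_arm_apart x y : ((arm_pos x).+1 < arm_pos y)%N ->
  gram (arm_vertex x) (arm_vertex y) = 0%R.
Proof.
move=> pos; rewrite /= arm_eqE.
have /negPf -> : arm_pos x != arm_pos y by rewrite neq_ltn (ltnW pos).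
have /negPf -> : arm_pos y != (arm_pos x).+1 by rewrite neq_ltn pos orbT.
have /negPf -> : arm_pos x != (arm_pos y).+1.
  by rewrite neq_ltn ltnS (ltnW (ltnW pos)).
by rewrite !andbF.
Qed.

Lemma arm_gen_braid i k : (k < (tnth A i).-1)%N ->
  arm_gen i k.+1 * (arm_gen i k * arm_gen i k.+1) =
  arm_gen i k * (arm_gen i k.+1 * arm_gen i k).
Proof.
case: k => [|k] ki.
  have [x <- x1] := arm_at ki; rewrite -x1 arm_genE.
  by apply: gen_braid; rewrite /= x1.
have [x xi xk] := arm_at ki; have [y yi yk] := arm_at (ltnW ki).
rewrite -xk -yk -{1 3 5}xi arm_genE -{1 2 3}yi arm_genE.
apply: gen_braid; rewrite gram_tA_sym; apply: gram_arm_near; first by rewrite yi.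
by rewrite xk yk.
Qed.

Lemma arm_gen_commute i j k : (j.+1 < k)%N -> (k <= (tnth A i).-1)%N ->
  commute (arm_gen i j) (arm_gen i k).
Proof.
case: k => [//|k] jk ki; have [x xi xk] := arm_at ki.
rewrite -xk -{2}xi arm_genE; case: j => [|j] in jk *.
  by apply: gen_commute; rewrite /= xk; case: k jk {ki xk}.
have [|y yi yk] := @arm_at i j; first by apply: ltn_trans ki; apply: ltnW.
rewrite -yk -yi arm_genE; apply: gen_commute; apply: gram_arm_apart.
by rewrite xk yk.
Qed.

Lemma arm_star_braid i : (0 < (tnth A i).-1)%N ->
  arm_gen i 1 * (gen star * arm_gen i 1) = gen star * (arm_gen i 1 * gen star).
Proof.
move=> /arm_at [x <- x1]; rewrite -x1 arm_genE.
by apply: gen_braid; rewrite /= x1.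
Qed.

Lemma arm_star_commute i k : (1 < k <= (tnth A i).-1)%N ->
  commute (gen star) (arm_gen i k).
Proof.
case: k => [//|k] /andP [k1 /arm_at [x <- xk]]; rewrite -xk arm_genE.
by apply: gen_commute; rewrite /= xk; case: k k1 {xk}.
Qed.

Lemma arm_sigma i : (0 < (tnth A i).-1)%N ->
  arm_gen i 1 * (ctransl i 0 * (arm_gen i 1 * ctransl i 0)) =
  ctransl i 0 * (arm_gen i 1 * (ctransl i 0 * arm_gen i 1)).
Proof.
move=> /arm_at [x <- x1]; rewrite -x1 arm_genE.
by have /pres_classP := pres_rel (W2 x1); rewrite !pres_classE.
Qed.

Lemma arm_local i k : (k < (tnth A i).-1)%N ->
  [/\ commute (ctransl i k ^ arm_gen i k.+1) (ctransl i k),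
      ctransl i k ^ arm_gen i k.+1 = ctransl i k * ctransl i k.+1,
      ctransl i k.+1 ^ arm_gen i k = ctransl i k.+1 * ctransl i k
    & ctransl i k.+1 ^ arm_gen i k.+1 = (ctransl i k.+1)^-1].
Proof.
exact: chain_local (@arm_gen_sq i) (gen_sq star) (@arm_gen_braid i)
  (@arm_gen_commute i) (@arm_star_braid i) (@arm_star_commute i) (@arm_sigma i) k.
Qed.

Lemma arm_transl_far i j k : (j.+1 < k)%N -> (k <= (tnth A i).-1)%N ->
  commute (ctransl i j) (arm_gen i k).
Proof.
exact: chain_transl_commute_far  (@arm_gen_commute i) (@arm_star_commute i) j k.
Qed.

Lemma arm_transl_back i j k : (j.+1 < k)%N -> (k <= (tnth A i).-1)%N ->
  commute (ctransl i k) (arm_gen i j).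
Proof.
exact: chain_transl_commute_back (@arm_gen_sq i) (gen_sq star) (@arm_gen_braid i)
  (@arm_gen_commute i) (@arm_star_braid i) (@arm_star_commute i) (@arm_sigma i) j k.
Qed.

Lemma arm_transl_commute i j k :
  (j <= (tnth A i).-1)%N -> (k <= (tnth A i).-1)%N ->
  commute (ctransl i j) (ctransl i k).
Proof.
exact: chain_transl_commute (@arm_gen_sq i) (gen_sq star) (@arm_gen_braid i)
  (@arm_gen_commute i) (@arm_star_braid i) (@arm_star_commute i) (@arm_sigma i) j k.
Qed.

Lemma arm_pos_le x : (arm_pos x <= (tnth A (tag x)).-1)%N.
Proof. by case: x => i o; apply: ltn_ord. Qed.

Definition root_transl (v : vertex (R_A A)) : G :=
  if v is Some x then ctransl (tag x) (arm_pos x)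
  else gen (tT_center A) * gen star.

Lemma root_transl_centerE :
  root_transl center = gen (tT_center A) * gen star.
Proof. by []. Qed.

Lemma root_transl_armE x : root_transl (arm_vertex x) = ctransl (tag x) (arm_pos x).
Proof. by []. Qed.

(** A generator on another arm that is not adjacent to the centre commutes with
    everything from which the translation is built.  For the first vertex of
    the other arm, (W3) provides the commutation with the first translation of
    the arm of x. *)
Lemma root_transl_arms_gen x y : tag x != tag y ->
  commute (root_transl (arm_vertex x)) (gen (tT_arm y)).
Proof.
move=> xy; apply: commute_sym.
have gen_far k : (0 < k <= arm_pos x)%N -> commute (gen (tT_arm y)) (arm_gen (tag x) k).
  case: k => // k /andP [_ kx].
  have [|z zx zk] := @arm_at (tag x) k; first exact: leq_trans kx (arm_pos_le x).
  rewrite -zk -zx arm_genE; apply: gen_commute; apply: gram_arms_far.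
  by rewrite zx eq_sym.
have [y1|yn1] := eqVneq (arm_pos y) 1%N; last first.
  apply: (@chain_transl_commute_from _ _ _ _ 0) => //.
  apply: commute_sym; rewrite -(arm_genE y).
  apply: (@arm_transl_far (tag y) 0 (arm_pos y)) (arm_pos_le y).
  by rewrite ltn_neqAle eq_sym yn1.
apply: (@chain_transl_commute_from _ _ _ _ 1) => // [|k /andP[k1 kx]]; last first.
  by apply: gen_far; rewrite kx ltnW.
have [z zx z1] : exists2 z : arm, tag z = tag x & arm_pos z = 1%N.
  by apply: arm_at; apply: leq_trans (arm_pos_le x).
have tz : ctransl (tag x) 1 = pres_class (tW_rel (A:=A)) (sigma_arm z).
  rewrite !pres_classE.
  rewrite -[LHS]/(root_transl center ^ arm_gen (tag x) 1 / root_transl center).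
  by rewrite -zx -{1}z1 arm_genE conjgE gen_inv -!mulgA.
rewrite tz /commute -pres_class_letter -!pres_class_mul; apply/pres_classP.
apply: pres_rel; have [ltzy|ltyz|eqzy] := ltngtP (tag z) (tag y).
- exact: W3'.
- exact: W3.
- by move: xy; rewrite -zx (ord_inj eqzy) eqxx.
Qed.

Lemma root_transl_commute (u v : vertex (R_A A)) :
  commute (root_transl u) (root_transl v).
Proof.
have cx x : commute (root_transl center) (root_transl (arm_vertex x)).
  exact: (@arm_transl_commute (tag x) 0 (arm_pos x)) (arm_pos_le x).
case: u v => [x|] [y|] //; last exact: cx.
  have [xy|xy] := eqVneq (tag x) (tag y).
    rewrite !root_transl_armE xy; apply: arm_transl_commute (arm_pos_le y).
    by rewrite -xy arm_pos_le.
  apply: (@chain_transl_commute_from _ _ _ _ 0) => // [|k /andP [k0 ky]].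
    exact/commute_sym/cx.
  case: k k0 ky => // k _ ky.
  have [|z zy zk] := @arm_at (tag y) k; first exact: leq_trans ky (arm_pos_le y).
  by rewrite -zk -zy arm_genE; apply: root_transl_arms_gen; rewrite zy.
exact/commute_sym/cx.
Qed.

Lemma gram_arm_cases x y : tag x = tag y ->
  x = y \/
  [\/ arm_pos y = (arm_pos x).+1, arm_pos x = (arm_pos y).+1,
      ((arm_pos x).+1 < arm_pos y)%N | ((arm_pos y).+1 < arm_pos x)%N].
Proof.
move=> xy; case: (ltngtP (arm_pos x) (arm_pos y)) => [||pos]; last first.
- by left; apply/eqP; rewrite arm_eqE xy pos !eqxx.
- rewrite leq_eqVlt => /orP [/eqP <-|lt]; right; first exact: Or42.
  exact: Or44.
- rewrite leq_eqVlt => /orP [/eqP <-|lt]; right; first exact: Or41.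
  exact: Or43.
Qed.

(** The tree generators act on the translations as the simple reflections act
    on the simple roots. *)
Lemma root_transl_conj (u v : vertex (R_A A)) :
  root_transl v ^ gen (Some u) =
  root_transl v * zexpg (root_transl u) (- gram v u)%R.
Proof.
have zm2 (g : G) : zexpg g (- 2)%R = g^-1 * g^-1 by rewrite /= invgM.
case: u v => [x|] [y|].
- rewrite -[Some (Some x)]/(tT_arm x).
  have [xy|xy] := eqVneq (tag x) (tag y); last first.
    rewrite gram_arms_far 1?eq_sym // mulg1; apply: conj_commute.
    by apply: root_transl_arms_gen; rewrite eq_sym.
  case: (gram_arm_cases xy) => [->|[pos|pos|pos|pos]].
  + rewrite gram_diag zm2 mulVKg !root_transl_armE -arm_genE.
    case Ek: (arm_pos y) (arm_pos_le y) => [//|k] /arm_local [_ _ _].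
    by rewrite -Ek.
  + rewrite gram_sym gram_arm_near // !root_transl_armE -arm_genE xy pos.
    have /arm_local [_ _ ->] : (arm_pos x < (tnth A (tag y)).-1)%N.
      by rewrite -pos arm_pos_le.
    by [].
  + rewrite gram_arm_near // !root_transl_armE -arm_genE xy pos.
    have /arm_local [_ -> _] : (arm_pos y < (tnth A (tag y)).-1)%N.
      by rewrite -pos -xy arm_pos_le.
    by [].
  + rewrite gram_sym gram_arm_apart // mulg1; apply: conj_commute.
    rewrite root_transl_armE -arm_genE xy.
    exact: arm_transl_back pos (arm_pos_le y).
  + rewrite gram_arm_apart // mulg1; apply: conj_commute.
    rewrite root_transl_armE -arm_genE -xy.
    exact: arm_transl_far pos (arm_pos_le x).
- have [x1|x1] := eqVneq (arm_pos x) 1%N.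
    have gx : gram center (arm_vertex x) = (-1)%R by rewrite /= x1.
    rewrite gx -[Some (Some x)]/(tT_arm x) -arm_genE root_transl_armE x1.
    have /arm_local [_ e _ _] : (0 < (tnth A (tag x)).-1)%N.
      exact: leq_trans (arm_pos_le x).
    exact: e.
  rewrite (_ : gram _ _ = 0)%R /= ?(negPf x1) // mulg1; apply: conj_commute.
  rewrite -[Some (Some x)]/(tT_arm x) -arm_genE.
  apply: (@arm_transl_far (tag x) 0 (arm_pos x)) (arm_pos_le x).
  by rewrite ltn_neqAle eq_sym x1.
- have [y1|y1] := eqVneq (arm_pos y) 1%N.
    have gy : gram (arm_vertex y) center = (-1)%R by rewrite /= y1.
    rewrite gy root_transl_armE y1.
    have /arm_local [_ _ e _] : (0 < (tnth A (tag y)).-1)%N.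
      exact: leq_trans (arm_pos_le y).
    exact: e.
  rewrite (_ : gram _ _ = 0)%R /= ?(negPf y1) // mulg1; apply: conj_commute.
  apply: (@arm_transl_back (tag y) 0 (arm_pos y)) (arm_pos_le y).
  by rewrite ltn_neqAle eq_sym y1.
- rewrite gram_diag zm2 mulVKg root_transl_centerE conjgE gen_inv invgM !gen_inv.
  by rewrite !mulgA gen_sq mul1g.
Qed.

End StarGroup.

(** * The isomorphism with the semi-direct product *)

Lemma bijective_of_surjective (T U : Type) (f : T -> U) :
  injective f -> (forall y, exists x, f x = y) -> bijective f.
Proof.
move=> f_inj f_surj; exists (fun y => sval (cid (f_surj y))) => [x|y].
  by apply: f_inj; case: cid.
by case: cid.
Qed.

Section StarIsomorphism.
Variables (r : nat) (A : r.-tuple nat).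
Local Open Scope group_scope.
Local Notation G := (W_tT_A A).
Local Notation gen := (@pres_gen (tT_A A) (@tW_rel r A) : tT_A A -> G).
Local Notation alpha := (@simple_root (R_A A)).
Local Notation center := (T_center A : vertex (R_A A)).
Local Notation arm_vertex x := (T_arm x : vertex (R_A A)).
Local Notation star := (tT_star A).
Local Notation tau := (@root_transl r A).
Local Notation transl := (lattice_transl tau).
Local Notation tree_gen := (fun v : vertex (R_A A) => gen (Some v)).
Local Notation tree_word := (prod_word tree_gen).
Variable phi : {multiplicative G -> semidirect (R_A A)}.
Hypothesis phiE : forall v, phi (gen v) = affine_gen v.

Lemma R_A_simply_laced (u v : vertex (R_A A)) :
  u != v -> gram u v = 0%R \/ gram u v = (-1)%R.
Proof.
case: u v => [x|] [y|] //= neq.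
- rewrite (_ : x == y = false); last exact: negbTE.
  by case: ifP; [right|left].
- by case: ifP; [right|left].
- by case: ifP; [right|left].
Qed.

Lemma transl_conj_word (u : seq (vertex (R_A A))) x :
  exists y, transl x ^ tree_word u = transl y.
Proof.
elim: u x => [|v u IHu] x; first by exists x; rewrite /prod_word big_nil conjg1.
have [y ey] := IHu (reflection v x); exists y.
rewrite -ey /prod_word big_cons conjgM; congr (_ ^ _).
apply: transl_conj => [|t]; first exact: root_transl_commute.
exact: root_transl_conj.
Qed.

Lemma star_gen_root_transl : gen star = gen (tT_center A) * tau center.
Proof. by rewrite root_transl_centerE mulgA gen_sq mul1g. Qed.

(** Left multiplication by a tree generator extends the word.  The generator of
    star is the central one times the central translation, and the latter moves
    past the word, turning into another translation. *)
Lemma normal_form (g : G) :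
  exists (u : seq (vertex (R_A A))) x, g = tree_word u * transl x.
Proof.
have cons_word (v : vertex (R_A A)) u :
    tree_word (v :: u) = gen (Some v) * tree_word u.
  exact: big_cons.
have step (v : tT_A A) (h : G) :
    (exists (u : seq (vertex (R_A A))) x, h = tree_word u * transl x) ->
    exists (u : seq (vertex (R_A A))) x, gen v * h = tree_word u * transl x.
  case=> u [x ->]; case: v => [v|].
    by exists (v :: u), x; rewrite cons_word mulgA.
  have [y ey] := transl_conj_word u (alpha center).
  exists (center :: u), (y + x)%R.
  rewrite translD; last exact: root_transl_commute.
  have {}ey : tau center ^ tree_word u = transl y.
    by rewrite -ey -[alpha center]mulr1z transl_simple.
  have key : gen star * tree_word u =
      gen (tT_center A) * (tree_word u * transl y).
    by rewrite -ey -conjgC [RHS]mulgA -star_gen_root_transl.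
  by rewrite mulgA key cons_word -!(mulgA (gen _)) -!(mulgA (tree_word u)).
elim/pres_ind: g => [|v h IH|v h IH].
- exists [::], 0%R; rewrite /prod_word big_nil transl0 ?mulg1 //.
  exact: root_transl_commute.
- exact: step.
- by rewrite (gen_inv v); apply: step.
Qed.

(** Under phi, conjugating the translation by a root and dividing by it gives
    the translation by the adjacent root. *)
Lemma affine_transl_step (t : G) (v : vertex (R_A A)) (x : arm A) :
  gram v (arm_vertex x) = (-1)%R -> phi t = sd_transl (alpha v) ->
  phi (t ^ gen (tT_arm x) / t) = sd_transl (alpha (arm_vertex x)).
Proof.
move=> vx et; rewrite conjgE !(gmulfM, multiplicativeV) et phiE affine_gen_arm.
rewrite -conjgE sd_transl_conj reflection_simple vx sd_translV sd_translM.
by rewrite mulrN1z opprK addrC addKr.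
Qed.

Lemma affine_transl x : phi (transl x) = sd_transl x.
Proof.
have affine_tau (v : vertex (R_A A)) : phi (tau v) = sd_transl (alpha v).
  case: v => [x1|].
    2: by rewrite root_transl_centerE gmulfM !phiE affine_gen_sigma.
  have [k] : exists k, arm_pos x1 = k.+1 by exists (tagged x1).
  rewrite root_transl_armE.
  elim: k x1 => [|k IHk] x1 Ek.
    rewrite Ek.
    rewrite -[chain_transl _ _ _]/(tau center ^ arm_gen A (tag x1) 1 / tau center).
    rewrite -{1}Ek arm_genE.
    apply: (@affine_transl_step _ center); first by rewrite /= Ek.
    by rewrite root_transl_centerE gmulfM !phiE affine_gen_sigma.
  have [|y yx yk] := @arm_at r A (tag x1) k.
    by apply: leq_trans (arm_pos_le x1); rewrite Ek.
  rewrite Ek /= -/(arm_gen A (tag x1) k.+2) -{1}Ek arm_genE.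
  apply: (@affine_transl_step _ (arm_vertex y)).
    by apply: gram_arm_near => //; rewrite yk Ek.
  by rewrite -IHk // yk yx.
have tC := @root_transl_commute r A.
move: x; apply: K0_ind => [|v|x y ex ey].
- by rewrite transl0 // multiplicative1.
- by rewrite -affine_tau -[alpha v]mulr1z transl_simple.
- rewrite translD // translN // gmulfM multiplicativeV ex ey.
  by rewrite sd_translV sd_translM.
Qed.

Lemma affine_tree_word u : sd_translation (phi (tree_word u)) = 0%R.
Proof.
elim: u => [|v u IHu]; first by rewrite /prod_word big_nil multiplicative1.
rewrite /prod_word big_cons gmulfM phiE sd_mulE /sd_mul /= -/(prod_word _ _) IHu.
by rewrite mulr0z aut0 addr0.
Qed.

(** On a normal form the linear part of the image is that of the word; once it
    is trivial, the translation part is the exponent vector itself. *)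
Lemma affine_injective : injective phi.
Proof.
apply: multiplicative_inj => g; have [u [x ->]] := normal_form g.
rewrite gmulfM affine_transl sd_mulE /sd_mul /= mulg1 affine_tree_word add0r.
case=> word1 x0.
pose linear (h : G) := Weyl_aut (sd_linear (phi h)).
have linearM : {morph linear : h k / h * k}.
  by move=> h k; rewrite /linear gmulfM -Weyl_autM.
pose rho : {multiplicative G -> Aut (R_A A)} :=
  HB.pack linear (isMultiplicative.Build _ _ linear linearM).
have -> : tree_word u = 1.
  apply: (@prod_word_eq1 _ R_A_simply_laced _ _ rho) => [v|v t|v t|v|].
  - exact: gen_sq.
  - exact: (@gen_commute r A (Some v) (Some t)).
  - exact: (@gen_braid r A (Some v) (Some t)).
  - by rewrite /= /linear phiE.
  - by rewrite /= /linear word1 Weyl_aut1.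
move: x0; rewrite word1 Weyl_aut1 aut_oneE => ->.
by rewrite transl0 ?mulg1 //; apply: root_transl_commute.
Qed.

Lemma affine_surjective p : exists g, phi g = p.
Proof.
have onto_linear (w : Weyl (R_A A)) : exists g, phi g = Semidirect w 0%R.
  suff [g [g0 gw]] : exists g, sd_translation (phi g) = 0%R /\
      Weyl_aut (sd_linear (phi g)) = Weyl_aut w.
    by exists g; move: g0 gw; case: (phi g) => w' x' /= -> /Weyl_inj ->.
  apply: (@Weyl_ind _ (fun a => exists g, sd_translation (phi g) = 0%R /\
      Weyl_aut (sd_linear (phi g)) = a)).
  - by exists 1; rewrite multiplicative1 Weyl_aut1.
  - move=> _ _ [g [g0 <-]] [h [h0 <-]]; exists (g / h).
    rewrite gmulfM multiplicativeV; split.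
      by rewrite sd_mulE /sd_mul /= h0 aut0 oppr0 aut0 addr0.
    by rewrite sd_mulE /sd_mul /= Weyl_autM.
  - by move=> u; exists (gen (Some u)); rewrite phiE /= mulr0z.
case: p => w x; have [g gw] := onto_linear w.
exists (transl x * g).
rewrite gmulfM affine_transl gw sd_mulE /sd_mul /= mul1g.
by rewrite Weyl_aut1 addr0.
Qed.

Lemma affine_bijective : bijective phi.
Proof. exact: bijective_of_surjective affine_injective affine_surjective. Qed.

End StarIsomorphism.

(** * The radical of the form of a star *)

Section StarRadical.
Variables (r : nat) (A : r.-tuple nat).
Hypothesis A_ge2 : forall i : 'I_r, (2 <= tnth A i)%N.
Local Notation arm := (arm A).
Local Notation alpha := (@simple_root (R_A A)).
Local Notation center := (T_center A : vertex (R_A A)).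
Local Notation arm_vertex x := (T_arm x : vertex (R_A A)).
Local Notation a i := (tnth A i).
Implicit Types (y : arm) (u v : vertex (R_A A)) (x : K0 (R_A A)).
Implicit Types (i : 'I_r) (k : nat).

(** Returning None past the end of an arm makes the coordinate just after the
    last vertex vanish, so that the form is given by the same second difference
    at all vertices of the arm. *)
Definition vertex_at i k : option (vertex (R_A A)) :=
  if k is k'.+1 then
    omap (fun o : 'I_(a i).-1 => arm_vertex (Tagged (fun j => 'I_(a j).-1) o))
      (insub k')
  else Some center.

Arguments vertex_at : simpl never.

Definition coord x i k : int := oapp x 0 (vertex_at i k).

Lemma vertex_at_arm y i k : (vertex_at i k == Some (arm_vertex y)) =
  (tag y == i) && (arm_pos y == k).
Proof.
case: k => [|k]; rewrite /vertex_at /=; first by rewrite andbF.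
case: insubP => [o _ <-|] /=.
  by rewrite [LHS]eq_sym -[LHS]/(y == _) arm_eqE.
move=> nk; apply/esym/negbTE; apply: contra nk => /andP [/eqP <- /eqP [<-]].
by case: y => j o /=; apply: ltn_ord.
Qed.

Lemma vertex_at_center i k : (vertex_at i k == Some center) = (k == 0)%N.
Proof. by case: k => [|k] //; rewrite /vertex_at; case: insubP. Qed.

Lemma sum_vertex_at x i k :
  \sum_v x v * (vertex_at i k == Some v)%:R = coord x i k.
Proof.
rewrite /coord; case: (vertex_at i k) => [w|] /=; last first.
  by rewrite big1 // => v _; rewrite mulr0.
rewrite (bigD1 w) //= eqxx mulr1 big1 ?addr0 // => v vw.
by rewrite [Some w == _]eq_sym -[_ == _]/(v == w) (negPf vw) mulr0.
Qed.

Lemma gram_arm u y : let i := tag y in let p := arm_pos y in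
  gram u (arm_vertex y) = 2 * (vertex_at i p == Some u)%:R
    - (vertex_at i p.-1 == Some u)%:R - (vertex_at i p.+1 == Some u)%:R.
Proof.
move=> i p; case: u => [z|]; last first.
  rewrite !vertex_at_center /=; rewrite /p /arm_pos /= eqSS.
  by case: eqP.
rewrite !vertex_at_arm /= arm_eqE /p.
have [_|//] := eqVneq (tag z) i; rewrite /=.
move: (arm_pos z) => q; rewrite /arm_pos; move: (nat_of_ord _) => m.
rewrite eqSS [m == q]eq_sym; have [->|_] := eqVneq q m.+1.
  by rewrite (gtn_eqF (ltnSn m)) (ltn_eqF (ltnSn m.+1)).
have [->|_] := eqVneq q m; first by rewrite (ltn_eqF (leqW (ltnSn m))).
by case: eqP.
Qed.

Lemma form_arm x y :
  form x (alpha (arm_vertex y)) = 2 * coord x (tag y) (arm_pos y)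
    - coord x (tag y) (arm_pos y).-1 - coord x (tag y) (arm_pos y).+1.
Proof.
rewrite form_simple_r -!sum_vertex_at mulr_sumr -!sumrB.
by apply: eq_bigr => u _; rewrite gram_arm; ring.
Qed.

Lemma gram_center u :
  gram u center = 2 * (u == center)%:R - \sum_i (vertex_at i 1 == Some u)%:R.
Proof.
case: u => [z|]; last first.
  by rewrite big1 ?subr0 // => i _; rewrite vertex_at_center.
rewrite (bigD1 (tag z)) //= big1 => [|i iz].
  by rewrite (vertex_at_arm z) eqxx /=; case: eqP.
by rewrite (vertex_at_arm z) eq_sym (negPf iz).
Qed.

Lemma form_center x :
  form x (alpha center) = 2 * x center - \sum_i coord x i 1.
Proof.
rewrite form_simple_r.
rewrite (eq_bigr (fun u => 2 * (x u * (u == center)%:R)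
    - \sum_i x u * (vertex_at i 1 == Some u)%:R)) => [|u _]; last first.
  by rewrite gram_center -mulr_sumr; ring.
rewrite sumrB -mulr_sumr (bigD1 center) //= big1 => [|u /negPf ->].
  2: by rewrite mulr0.
rewrite mulr1 addr0 exchange_big /=; congr (_ - _).
by apply: eq_bigr => i _; apply: sum_vertex_at.
Qed.

Lemma coord0 x i : coord x i 0 = x center. Proof. by []. Qed.

Lemma coord_end x i : coord x i (a i) = 0.
Proof.
have <- : (a i).-1.+1 = a i by rewrite prednK // (leq_trans _ (A_ge2 i)).
by rewrite /coord /vertex_at insubN // ltnn.
Qed.

Lemma coord_arm x y : coord x (tag y) (arm_pos y) = x (arm_vertex y).
Proof.
rewrite /coord.
have /eqP -> // : vertex_at (tag y) (arm_pos y) == Some (arm_vertex y).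
by rewrite vertex_at_arm !eqxx.
Qed.

Definition arms_orthogonal x := forall y, form x (alpha (arm_vertex y)) = 0.
Definition radical x := forall v, form x (alpha v) = 0.

(** Orthogonality to the arm roots means that the second differences vanish, so
    the coordinates along arm i form an arithmetic progression from the central
    coordinate at position 0 to zero at position a_i. *)
Lemma coord_linear x i k : arms_orthogonal x -> (k <= a i)%N ->
  (a i)%:Z * coord x i k = x center * ((a i)%:Z - k%:Z).
Proof.
move=> ox; set d := coord x i 1 - coord x i 0.
have coordE m : (m < a i)%N -> coord x i m = x center + m%:Z * d /\
    coord x i m.+1 = x center + m.+1%:Z * d.
  elim: m => [|m IHm] lt_m.
    by rewrite mul0r addr0 mul1r /d !coord0; split=> //; ring.
  have [em em1] := IHm (ltnW lt_m); split=> //.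
  have [|y yi yk] := @arm_at r A i m.
    by rewrite -ltnS prednK // (leq_trans _ (A_ge2 i)).
  have := ox y; rewrite form_arm yi yk /= em em1 => /eqP.
  rewrite subr_eq0 => /eqP <-.
  by rewrite -[m.+2]addn1 -[m.+1]addn1 !PoszD; ring.
have a_gt0 : (0 < a i)%N by apply: leq_trans (A_ge2 i).
have coordE' m : (m <= a i)%N -> coord x i m = x center + m%:Z * d.
  case: m => [|m] lt_m; last by have [] := coordE m lt_m.
  by have [] := coordE 0%N a_gt0.
have aE : (a i)%:Z * d = - x center.
  have := coordE' _ (leqnn (a i)); rewrite coord_end => /esym/eqP.
  by rewrite addrC addr_eq0 => /eqP.
move=> le_k; rewrite coordE' // mulrDr mulrCA aE; ring.
Qed.

(** The first coordinate on arm i is (1 - 1/a_i) times the central one; summing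
    over the arms turns the pairing with the central root into chi_A times the
    central coordinate. *)
Lemma form_center_chi x : arms_orthogonal x ->
  (form x (alpha center))%:~R = (x center)%:~R * chi_A A :> rat.
Proof.
move=> ox; rewrite form_center /chi_A rmorphB rmorphM /= rmorph_sum mulrDr.
rewrite [2%:~R * _]mulrC; congr (_ + _); rewrite -sumrN mulr_sumr.
apply: eq_bigr => i _.
have a_gt0 : (0 < a i)%N by apply: leq_trans (A_ge2 i).
have a_neq0 : (a i)%:R != 0 :> rat by rewrite pnatr_eq0 -lt0n.
have := congr1 (fun n : int => n%:~R : rat) (coord_linear (k := 1) ox a_gt0).
rewrite !(rmorphM, rmorphB) /= => e.
apply: (mulfI a_neq0); rewrite mulrN [X in - X]e.
by field.
Qed.

Lemma radical_center_eq0 x : arms_orthogonal x -> x center = 0 -> x = 0.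
Proof.
move=> ox x0; apply/ffunP => -[y|]; rewrite K0_zeroE; last exact: x0.
have := coord_linear ox (leq_trans (arm_pos_le y) (leq_pred _)).
rewrite x0 mul0r coord_arm => /eqP; rewrite mulf_eq0 => /orP [/eqP a0|/eqP//].
by have := A_ge2 (tag y); case: a0 => ->.
Qed.

Lemma radical_eq0 x : chi_A A != 0 -> radical x -> x = 0.
Proof.
move=> chi_neq0 rx; have ox : arms_orthogonal x by move=> y; apply: rx.
apply: radical_center_eq0 => //.
have := form_center_chi ox; rewrite rx => /esym/eqP.
by rewrite mulf_eq0 (negPf chi_neq0) orbF intr_eq0 => /eqP.
Qed.

Definition arm_lcm : nat := \big[lcmn/1%N]_i a i.

Lemma dvdn_arm_lcm i : (a i %| arm_lcm)%N.
Proof. by rewrite /arm_lcm (biglcmn_sup i). Qed.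

Lemma arm_lcm_gt0 : (0 < arm_lcm)%N.
Proof.
apply: (big_ind (fun n => (0 < n)%N)) => // [m n m0 n0|i _].
  by rewrite lcmn_gt0 m0.
exact: leq_trans (A_ge2 i).
Qed.

(** The arithmetic progressions of coord_linear with the smallest positive
    central coordinate for which all of them are integral. *)
Definition radical_gen : K0 (R_A A) :=
  [ffun v : vertex (R_A A) => if v is Some y then
     (arm_lcm %/ a (tag y))%:Z * ((a (tag y))%:Z - (arm_pos y)%:Z)
   else arm_lcm%:Z].

Lemma radical_gen_center : radical_gen center = arm_lcm%:Z.
Proof. by rewrite ffunE. Qed.

Lemma coord_radical_gen i k : (k <= a i)%N ->
  coord radical_gen i k = (arm_lcm %/ a i)%:Z * ((a i)%:Z - k%:Z).
Proof.
case: k => [_|k].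
  by rewrite coord0 radical_gen_center subr0 -PoszM divnK ?dvdn_arm_lcm.
rewrite leq_eqVlt => /orP [/eqP ->|lt_k]; first by rewrite coord_end subrr mulr0.
have [|y <- <-] := @arm_at r A i k.
  by rewrite -ltnS prednK // (leq_trans _ (A_ge2 i)).
by rewrite coord_arm ffunE.
Qed.

Lemma arms_orthogonal_radical_gen : arms_orthogonal radical_gen.
Proof.
move=> y; have a_gt0 := ltnW (A_ge2 (tag y)).
have lt_y : ((arm_pos y).+1 <= a (tag y))%N.
  by rewrite -(prednK a_gt0) ltnS arm_pos_le.
have le_y := ltnW lt_y; have le_y' := leq_trans (leq_pred _) le_y.
rewrite form_arm !coord_radical_gen //= -[(arm_pos y).+1]addn1.
by rewrite /arm_pos -[(nat_of_ord _).+1]addn1 !PoszD; ring.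
Qed.

Lemma radical_radical_gen : chi_A A = 0 -> radical radical_gen.
Proof.
move=> chi0 [y|]; first exact: arms_orthogonal_radical_gen.
have := form_center_chi arms_orthogonal_radical_gen.
by rewrite chi0 mulr0 => /eqP; rewrite intr_eq0 => /eqP.
Qed.

(** The coordinate at position 1 being an integer, every a_i divides the central
    coordinate, so their least common multiple does; and a vector orthogonal to
    the arm roots is determined by its central coordinate. *)
Lemma radical_multiple x : radical x -> exists n, x = radical_gen *~ n.
Proof.
move=> rx; have ox : arms_orthogonal x by move=> y; apply: rx.
have [n en] : exists n, x center = arm_lcm%:Z * n.
  have /dvdnP [m em] : (arm_lcm %| `|x center|)%N.
    apply/dvdn_biglcmP => i _.
    have a_gt0 : (0 < a i)%N by apply: leq_trans (A_ge2 i).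
    have -> : x center = (a i)%:Z * (x center - coord x i 1).
      by rewrite mulrBr (coord_linear ox a_gt0); ring.
    by rewrite abszM dvdn_mulr.
  exists (m%:Z * sgz (x center)).
  by rewrite {1}[x center]intEsg em PoszM; ring.
exists n; apply/eqP; rewrite -subr_eq0; apply/eqP/radical_center_eq0.
  move=> y; rewrite formBl formMl ox arms_orthogonal_radical_gen.
  by rewrite mulr0 subr0.
by rewrite !K0E radical_gen_center en subrr.
Qed.

End StarRadical.

(** * Central extensions generated by involutions *)

(** A section s satisfies s (p g) = iota n * g for some n.  For an involution g,
    squaring gives iota (2 n) = 1, so n = 0.  Hence s o p is the identity on the
    generators, and p is injective, contradicting that it kills iota 1. *)
Lemma no_section_of_involutions (X : choiceType) (R : word X -> word X -> Prop)
  (H : groupType) (iota : int -> presented R) (p : {multiplicative presented R -> H}) :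
  (forall x, pres_gen R x * pres_gen R x = 1)%g ->
  central_extension_by_Z iota p -> ~ trivial_extension p.
Proof.
move=> gen2 [iotaM iota_inj _ kerP iotaC] [s sK].
have iota0 : iota 0 = 1%g by apply: (mulgI (iota 0)); rewrite -iotaM addr0 mulg1.
have s_gen x : s (p (pres_gen R x)) = pres_gen R x.
  set g := pres_gen R x; have [n en] : exists n, (s (p g) / g)%g = iota n.
    by apply/kerP; rewrite gmulfM multiplicativeV sK mulgV.
  have {en} sg : s (p g) = (iota n * g)%g by rewrite -en mulgVK.
  have sg2 : (s (p g) * s (p g) = 1)%g.
    by rewrite -!gmulfM gen2 !multiplicative1.
  have n0 : iota (n + n) = iota 0.
    rewrite iota0 -sg2 sg iotaM -!mulgA; congr (_ * _)%g.
    by rewrite mulgA -iotaC -!mulgA gen2 mulg1.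
  have nn := iota_inj _ _ n0.
  have -> : s (p g) = (iota 0 * g)%g; last by rewrite iota0 mul1g.
  rewrite sg; congr (iota _ * _)%g; apply/eqP.
  by move/eqP: nn; rewrite -mulr2n mulrn_eq0.
have sp g : s (p g) = g.
  elim/pres_ind: g => [|x g IHg|x g IHg]; first by rewrite !multiplicative1.
    by rewrite !gmulfM IHg s_gen.
  by rewrite !(gmulfM, multiplicativeV) IHg s_gen.
have p1 : p (iota 1) = 1%g by apply/kerP; exists 1.
have /iota_inj : iota 1 = iota 0 by rewrite -[LHS]sp p1 multiplicative1 iota0.
by [].
Qed.

(** * The action on the extended root lattice *)

Section EllipticAction.
Variables (r : nat) (A : r.-tuple nat).
Local Notation center := (T_center A : vertex (R_A A)).
Local Notation alpha := (@simple_root (R_A A)).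
Local Notation talpha := (@simple_root (tR_A A)).
Local Notation tK0 := (K0 (tR_A A)).
Implicit Types (x y : K0 (R_A A)) (l m : tK0) (p q : semidirect (R_A A)).

Definition star_coord l : int := l (tT_star A : vertex (tR_A A)).

(** The projection of the extended lattice onto K_0(R_A) that identifies the
    root of star with the central root.  Together with star_coord it splits off
    the line spanned by alpha_star - alpha_1. *)
Definition collapse l : K0 (R_A A) :=
  [ffun v : vertex (R_A A) => l (Some v : vertex (tR_A A))]
  + alpha center *~ star_coord l.

(** The inverse of l |-> (collapse l, star_coord l): it puts n times
    alpha_star - alpha_1 on top of x. *)
Definition uncollapse x (n : int) : tK0 :=
  [ffun v : vertex (tR_A A) =>
     if v is Some u then (x - alpha center *~ n) u else n].

Lemma collapseK x n : collapse (uncollapse x n) = x.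
Proof.
apply/ffunP => u; rewrite /collapse /star_coord K0_addE !ffunE.
by rewrite subrK.
Qed.

Lemma star_coordK x n : star_coord (uncollapse x n) = n.
Proof. by rewrite /star_coord ffunE. Qed.

Lemma collapse_ext l m :
  collapse l = collapse m -> star_coord l = star_coord m -> l = m.
Proof.
move=> clm slm; apply/ffunP => -[u|]; last exact: slm.
move/(congr1 (fun f : K0 (R_A A) => f u)): clm.
by rewrite /collapse !K0_addE slm => /addIr; rewrite !ffunE.
Qed.

Lemma collapseD l m : collapse (l + m) = collapse l + collapse m.
Proof.
rewrite /collapse /star_coord !K0_addE mulrzDr addrACA; congr (_ + _).
by apply/ffunP => u; rewrite K0_addE !ffunE.
Qed.

Lemma collapseN l : collapse (- l) = - collapse l.
Proof.
rewrite /collapse /star_coord !K0_oppE mulrNz opprD; congr (_ + _).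
by apply/ffunP => u; rewrite K0_oppE !ffunE.
Qed.

Lemma collapseMz l n : collapse (l *~ n) = collapse l *~ n.
Proof.
rewrite /collapse /star_coord; apply/ffunP => u.
by rewrite !K0E !ffunE !K0E; ring.
Qed.

Lemma collapse0 : collapse 0 = 0.
Proof. by rewrite -(subrr 0) collapseD collapseN subrr. Qed.

Lemma collapse_simple (v : vertex (tR_A A)) : collapse (talpha v) = alpha (shadow v).
Proof.
apply/ffunP => u; rewrite /collapse /star_coord !K0E !ffunE.
by case: v => [v|]; rewrite /= ?mulr0 ?addr0 ?mulr1 ?add0r.
Qed.

Lemma form_collapse l m : form l m = form (collapse l) (collapse m).
Proof.
have form0 (B : rootBasis) (z : K0 B) : form 0 z = 0.
  by rewrite -(subrr 0) formBl subrr.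
have formBr (B : rootBasis) (z t w : K0 B) :
    form w (z - t) = form w z - form w t.
  by rewrite !(form_sym w) formBl.
move: l; apply: K0_ind => [|v|l l' el el'].
- by rewrite collapse0 !form0.
- move: m; apply: K0_ind => [|u|m m' em em'].
  + by rewrite collapse0 ![form _ 0]form_sym !form0.
  + by rewrite !collapse_simple !form_simple; apply: gram_tAE.
  + by rewrite collapseD collapseN !formBr em em'.
- by rewrite collapseD collapseN !formBl el el'.
Qed.

(** The translation part acts by the shear along the null line
    alpha_star - alpha_1 defined by the functional - I(_, x); the minus sign is
    the one for which the affine reflection attached to star becomes the
    reflection in the root of star. *)
Definition tilde_act_fun p l : tK0 :=
  let wl := Weyl_aut (sd_linear p) (collapse l) in
  uncollapse wl (star_coord l - form wl (sd_translation p)).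

Lemma collapse_tilde_act p l :
  collapse (tilde_act_fun p l) = Weyl_aut (sd_linear p) (collapse l).
Proof. exact: collapseK. Qed.

Lemma star_coord_tilde_act p l : star_coord (tilde_act_fun p l) = star_coord l -
  form (Weyl_aut (sd_linear p) (collapse l)) (sd_translation p).
Proof. exact: star_coordK. Qed.

Lemma tilde_act_funM p q l :
  tilde_act_fun (p * q)%g l = tilde_act_fun p (tilde_act_fun q l).
Proof.
apply: collapse_ext.
  by rewrite !collapse_tilde_act sd_mulE /= Weyl_autM.
rewrite !star_coord_tilde_act collapse_tilde_act sd_mulE /= Weyl_autM.
rewrite aut_mulE formDr.
have [_ _ isometry] := autP (Weyl_aut (sd_linear p)).
by rewrite isometry; ring.
Qed.

Lemma tilde_act_fun1 l : tilde_act_fun 1%g l = l.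
Proof.
apply: collapse_ext; first by rewrite collapse_tilde_act /= Weyl_aut1.
by rewrite star_coord_tilde_act /= form_sym -(subrr 0) formBl subrr subr0.
Qed.

Lemma tilde_act_fun_automorphism p : is_automorphism (tilde_act_fun p).
Proof.
split=> [l m||l m].
- apply: collapse_ext.
    by rewrite collapseD !collapse_tilde_act collapseD autD.
  rewrite [star_coord (_ + _)]K0_addE !star_coord_tilde_act.
  rewrite -[tilde_act_fun p l _]/(star_coord _).
  rewrite -[tilde_act_fun p m _]/(star_coord _) !star_coord_tilde_act.
  by rewrite collapseD autD formDl [star_coord (_ + _)]K0_addE /star_coord; ring.
- exists (tilde_act_fun p^-1%g) => l; rewrite -tilde_act_funM ?mulVg ?mulgV;
  exact: tilde_act_fun1.
- rewrite !form_collapse !collapse_tilde_act.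
  by have [_ _ ->] := autP (Weyl_aut (sd_linear p)).
Qed.

Definition tilde_act p : Aut (tR_A A) := mk_aut (tilde_act_fun_automorphism p).

Lemma tilde_actM : {morph tilde_act : p q / (p * q)%g}.
Proof. by move=> p q; apply: aut_ext => l; apply: tilde_act_funM. Qed.

Lemma tilde_act_affine_gen v :
  tilde_act (affine_gen v) = reflection (v : vertex (tR_A A)).
Proof.
apply: aut_ext => l; rewrite -[LHS]/(tilde_act_fun _ l).
have formE : form l (talpha v) = form (collapse l) (alpha (shadow v)).
  by rewrite form_collapse collapse_simple.
apply: collapse_ext.
  rewrite collapse_tilde_act /= reflectionE [RHS]collapseD collapseN collapseMz.
  by rewrite collapse_simple formE.
rewrite star_coord_tilde_act /= reflectionE formMr formBl formMl form_simple.
rewrite gram_diag.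
rewrite /star_coord !K0E formE simple_rootE.
by case: v {formE} => [v|] /=; ring.
Qed.

(** A trivial action forces w = 1 on the quotient by the null line, and then
    the shear vanishes exactly when x pairs to zero with every root. *)
Lemma tilde_act_eq1 p :
  tilde_act p = 1%g <-> sd_linear p = 1%g /\ radical (sd_translation p).
Proof.
split=> [p1|[]].
  have p1E l : tilde_act_fun p l = l.
    by rewrite -[LHS]/(aut_fun (tilde_act p) l) p1.
  have lin1 : sd_linear p = 1%g.
    apply: Weyl_inj; rewrite Weyl_aut1; apply: aut_ext => x.
    by have := collapse_tilde_act p (uncollapse x 0); rewrite p1E collapseK.
  split=> // v; have := star_coord_tilde_act p (uncollapse (alpha v) 0).
  rewrite p1E star_coordK collapseK lin1 Weyl_aut1 aut_oneE sub0r => /esym/eqP.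
  by rewrite oppr_eq0 form_sym => /eqP.
case: p => w x /= -> rx; apply: aut_ext => l; rewrite -[LHS]/(tilde_act_fun _ l).
apply: collapse_ext; first by rewrite collapse_tilde_act /= Weyl_aut1.
rewrite star_coord_tilde_act /= Weyl_aut1 aut_oneE form_sym.
suff -> : form x (collapse l) = 0 by rewrite subr0.
move: (collapse l); apply: K0_ind => [|v|y z ey ez]; last 1 first.
- by rewrite form_sym formBl !(form_sym _ x) ey ez subrr.
- by rewrite form_sym -(subrr 0) formBl subrr.
- exact: rx.
Qed.

(** This is what makes the translations by radical vectors central. *)
Lemma radical_fixed (w : Weyl (R_A A)) x : radical x -> Weyl_aut w x = x.
Proof.
move=> rx; move: w.
apply: (@Weyl_ind _ (fun a => aut_fun a x = x)) => [//|g h gx hx|v].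
  rewrite aut_mulE -[in LHS]hx.
  by rewrite -[aut_fun h^-1%g _]/(aut_fun (h^-1 * h)%g x) mulVg.
by rewrite reflectionE rx mulr0z subr0.
Qed.

End EllipticAction.

Section Projection.
Variables (r : nat) (A : r.-tuple nat).
Local Notation G := (W_tT_A A).
Local Notation gen := (@pres_gen (tT_A A) (@tW_rel r A) : tT_A A -> G).
Variable phi : {multiplicative G -> semidirect (R_A A)}.
Hypothesis phiE : forall v, phi (gen v) = affine_gen v.

Lemma tilde_act_generated g :
  generated (fun a : Aut (tR_A A) => exists v, a = reflection v)
    (tilde_act (phi g)).
Proof.
set S := fun a : Aut _ => _.
have [S1 SF] := generated_closed S.
have Sr v : reflection (v : vertex (tR_A A)) \in generated S.
  by apply: generated_sub; exists v.
have SM := group_closedM (generated_closed S).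
elim/pres_ind: g => [|v g IHg|v g IHg].
- rewrite multiplicative1 (_ : tilde_act 1%g = 1%g) //.
  by apply: aut_ext => l; apply: tilde_act_fun1.
- by rewrite gmulfM phiE tilde_actM tilde_act_affine_gen; apply: SM.
- by rewrite (gen_inv v) gmulfM phiE tilde_actM tilde_act_affine_gen; apply: SM.
Qed.

Definition tilde_proj_fun g : Weyl (tR_A A) :=
  exist _ (tilde_act (phi g)) (tilde_act_generated g).

Lemma tilde_proj_funM : {morph tilde_proj_fun : g h / (g * h)%g}.
Proof.
move=> g h; apply: Weyl_inj; rewrite Weyl_autM.
by rewrite -[LHS]/(tilde_act (phi (g * h)%g)) gmulfM tilde_actM.
Qed.

Definition tilde_proj : {multiplicative G -> Weyl (tR_A A)} :=
  HB.pack tilde_proj_fun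
    (isMultiplicative.Build _ _ tilde_proj_fun tilde_proj_funM).

Lemma tilde_proj_surj w : exists g, tilde_proj g = w.
Proof.
suff [g gw] : exists g, Weyl_aut (tilde_proj g) = Weyl_aut w.
  by exists g; apply: Weyl_inj.
apply: (@Weyl_ind _ (fun a => exists g, Weyl_aut (tilde_proj g) = a)).
- by exists 1%g; rewrite multiplicative1 Weyl_aut1.
- move=> _ _ [g <-] [h <-]; exists (g / h)%g.
  by rewrite gmulfM multiplicativeV Weyl_autM.
- move=> u; exists (gen u).
  by rewrite -[LHS]/(tilde_act (phi (gen u))) phiE tilde_act_affine_gen.
Qed.

Lemma tilde_proj_eq1 g : tilde_proj g = 1%g <->
  sd_linear (phi g) = 1%g /\ radical (sd_translation (phi g)).
Proof.
rewrite -tilde_act_eq1; split=> [pg|ag].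
  by have := congr1 (@Weyl_aut _) pg; rewrite Weyl_aut1.
by apply: Weyl_inj; rewrite Weyl_aut1.
Qed.

End Projection.

Theorem theorem4p5 (r : nat) (A : r.-tuple nat)
    (r_ge3 : (3 <= r)%N) (A_ge2 : forall i : 'I_r, (2 <= tnth A i)%N) :
  [/\ group_isomorphic (W_tT_A A) (semidirect (R_A A)),
      chi_A A != 0 -> group_isomorphic (W_tT_A A) (Weyl (tR_A A))
    & chi_A A = 0 -> is_hyperbolic_extension A (W_tT_A A)].
Proof.
have [phi phiE] := @affine_morphism_exists r A.
have phi_isom : group_isomorphic (W_tT_A A) (semidirect (R_A A)).
  by exists phi; apply: affine_bijective.
have phi_injective := affine_injective phiE.
split=> // [chi_neq0|chi0].
  exists (tilde_proj phiE).
  apply: bijective_of_surjective (@tilde_proj_surj _ _ _ phiE).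
  apply: multiplicative_inj => g.
  move=> /tilde_proj_eq1 [lin1 /(radical_eq0 A_ge2 chi_neq0) tr0].
  apply: phi_injective; rewrite multiplicative1.
  by case: (phi g) lin1 tr0 => w x /= -> ->.
split=> //.
have [psi phiK psiK] := affine_bijective phiE.
(* The central copy of Z is the preimage under phi of the translations by the
   radical. *)
pose rho := radical_gen A.
pose iota n := psi (sd_transl (rho *~ n)).
have rho_radical n : radical (rho *~ n).
  by move=> v; rewrite formMl (radical_radical_gen A_ge2 chi0) mulr0.
have phi_iota n : phi (iota n) = sd_transl (rho *~ n) by rewrite psiK.
have central : central_extension_by_Z iota (tilde_proj phiE).
  split.
  - move=> m n; apply: phi_injective.
    by rewrite gmulfM !phi_iota sd_translM mulrzDr.
  - move=> m n mn.
    have [] : sd_transl (rho *~ m) = sd_transl (rho *~ n) by rewrite -!phi_iota mn.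
    move=> /(congr1 (fun x : K0 (R_A A) => x (T_center A))).
    rewrite !K0_mulrzE radical_gen_center => /mulfI; apply.
    by rewrite -lt0n /= (arm_lcm_gt0 A_ge2).
  - exact: tilde_proj_surj.
  - move=> g; rewrite tilde_proj_eq1.
    split=> [[lin1 /(radical_multiple A_ge2) [n trn]]|[n ->]].
      exists n; apply: phi_injective; rewrite phi_iota.
      by case: (phi g) lin1 trn => w x /= -> ->.
    by rewrite phi_iota; split=> //; apply: rho_radical.
  - move=> n g; apply: phi_injective; rewrite !gmulfM phi_iota.
    case: (phi g) => w x.
    rewrite !sd_mulE /sd_mul /= mul1g mulg1 Weyl_aut1 aut_oneE.
    by rewrite (radical_fixed _ (rho_radical n)) addrC.
exists iota, (tilde_proj phiE); split=> //.
exact: no_section_of_involutions (@gen_sq r A) central.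
Qed.
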